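(* Let $k$ be a field, let $G$ be any finite simple graph with vertex set $V_G=\{x_1,\ldots,x_n\}$, and let $I(G)\subseteq R=k[x_1,\ldots,x_n]$ be its edge ideal. Then $$\beta_{2,4}(I(G)) = \sum_{v\in V_G} \binom{\deg v}{3} - k_4(G) + k_{2,2}(G)$$ and $$\beta_{3,5}(I(G)) = \sum_{v \in V_G}\binom{\deg v}{4} - k_5(G) + k_{2,3}(G) + w_4(G) + d(G),$$ where $d(G)$ is the number of induced subgraphs of $G$ isomorphic to the graph $D$ on five vertices $a,b,c,d,e$ with edge set $\{\{a,b\},\{a,c\},\{b,d\},\{c,d\},\{b,e\},\{c,e\},\{d,e\}\}$.
   Context: A simple graph has no loops or multiple edges; it need not be connected. The edge ideal of $G$, with edge set $E_G$, is $I(G)=\langle x_ix_j \mid \{x_i,x_j\}\in E_G\rangle\subseteq R=k[x_1,\ldots,x_n]$. For a homogeneous ideal $I\subseteq R$ (standard grading), the graded Betti numbers are $\beta_{i,j}(I)=\dim_k \operatorname{Tor}^R_i(I,k)_j$. The degree $\deg v$ of a vertex $v$ is the number of edges incident to $v$. For $S\subseteq V_G$, $G_S$ denotes the induced subgraph on $S$. The numbers $k_m(G)$, $k_{a,b}(G)$, $w_m(G)$ are the numbers of induced subgraphs of $G$ (i.e. of subsets $S\subseteq V_G$ with $G_S$) isomorphic respectively to the complete graph $K_m$, the complete bipartite graph $K_{a,b}$, and the wheel $W_m$. Here $W_m$ is the graph on $m+1$ vertices obtained from the cycle $C_m$ by adding a new vertex $z$ and joining $z$ to every vertex of $C_m$.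 *)

(* Defs.v *)
From HB Require Import structures.
From mathcomp Require Import all_boot all_order all_algebra.
From mathcomp Require Import mpoly.

Set Implicit Arguments.
Unset Strict Implicit.
Unset Printing Implicit Defensive.

Import GRing.Theory.

Local Open Scope ring_scope.

Section GradedBettiNumbers.

Variables (k : fieldType) (n : nat).
Local Notation R := {mpoly k[n]}.

Definition ideal_gen (S : R -> Prop) (f : R) : Prop :=
  exists (m : nat) (c s : 'I_m -> R),
    (forall i, S (s i)) /\ f = \sum_(i < m) c i * s i.

(* A resolution  ... -> F_1 -> F_0 -> I -> 0  of the ideal I by finitely
   generated graded free R-modules, in coordinates:
     F_i = \bigoplus_(a < res_rank i) R(- res_deg a),
   elements of F_i are row vectors, maps act by right multiplication. *)
Record graded_free_resolution (I : R -> Prop) := GradedFreeResolution {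
  res_rank : nat -> nat;
  res_deg : forall i, 'I_(res_rank i) -> nat;
  res_diff : forall i, 'M[R]_(res_rank i.+1, res_rank i);
  res_aug : 'cV[R]_(res_rank 0);
  (* The maps are homogeneous of degree 0: the (a, b) entry is a form of
     degree deg a - deg b, hence zero when this is negative. *)
  res_diff_homog : forall i a b m, m \in msupp (res_diff i a b) ->
    (mdeg m + res_deg b)%N = res_deg a;
  res_aug_homog : forall a b m, m \in msupp (res_aug a b) ->
    mdeg m = res_deg a;
  res_aug_image : forall f : R,
    I f <-> exists w : 'rV[R]_(res_rank 0), f = (w *m res_aug) 0 0;
  res_exact0 : forall v : 'rV[R]_(res_rank 0),
    v *m res_aug = 0 <-> exists w, v = w *m res_diff 0;
  res_exact : forall i (v : 'rV[R]_(res_rank i.+1)),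
    v *m res_diff i = 0 <-> exists w, v = w *m res_diff i.+1
}.

Arguments res_deg {I} g {i} : rename.

Section Tor.

Variables (I : R -> Prop) (F : graded_free_resolution I).

(* F_(i+1) (x) k -> F_i (x) k, where k = R / (x_1, ..., x_n): only the
   constant terms of the entries survive. *)
Definition res_diffk i : 'M[k]_(res_rank F i.+1, res_rank F i) :=
  map_mx (mcoeff 0%MM) (res_diff F i).

(* The row space of this matrix is (F_i (x) k)_j, spanned by the basis
   vectors of degree j. *)
Definition chains (i j : nat) : 'M[k]_(res_rank F i) :=
  diag_mx (\row_(a < res_rank F i) (res_deg F a == j)%:R).

Definition cycles (i j : nat) : 'M[k]_(res_rank F i) :=
  match i with
  | 0 => chains 0 j
  | i'.+1 => (chains i'.+1 j :&: kermx (res_diffk i'))%MS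
  end.

Definition boundaries (i j : nat) : 'M[k]_(res_rank F i.+1, res_rank F i) :=
  chains i.+1 j *m res_diffk i.

Lemma boundaries_sub_cycles i j : (boundaries i j <= cycles i j)%MS.
Proof.
have sub_chains: (boundaries i j <= chains i j)%MS.
  suff -> : boundaries i j = boundaries i j *m chains i j by apply: submxMl.
  rewrite /boundaries /chains.
  apply/matrixP=> a b; rewrite mul_mx_diag mul_diag_mx !mxE.
  case: eqP => [Ea|_]; last by rewrite !mul0r.
  case: eqP => [_|nEb]; first by rewrite mulr1.
  rewrite mulr0 mul1r; apply: memN_msupp_eq0; apply/negP.
  by move/(res_diff_homog); rewrite mdeg0 add0n Ea.
case: i sub_chains => [//|i] sub_chains.
rewrite /cycles sub_capmx sub_chains; apply/sub_kermxP.
rewrite /boundaries -mulmxA /res_diffk -map_mxM.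
suff -> : res_diff F i.+1 *m res_diff F i = 0 by rewrite map_mx0 mulmx0.
apply/row_matrixP=> a; rewrite row_mul row0; apply/res_exact.
by exists (delta_mx 0 a); rewrite rowE.
Qed.

(* dim_k Tor^R_i(I, k)_j = dim_k H_i(F (x)_R k)_j *)
Definition betti (i j : nat) : nat := (\rank (cycles i j) - \rank (boundaries i j))%N.

End Tor.

Definition edge_ideal (e : rel 'I_n) : R -> Prop :=
  ideal_gen (fun f => exists i j : 'I_n, e i j /\ f = 'X_i * 'X_j).

End GradedBettiNumbers.

Section InducedSubgraphs.

Definition degree (V : finType) (e : rel V) (v : V) : nat :=
  #|[set w | e v w]|.

Definition induced_iso (V U : finType) (e : rel V) (h : rel U)
    (S : {set V}) : bool :=
  [exists f : {ffun U -> V},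
    [&& injectiveb f, f @: [set: U] == S
      & [forall a, forall b, e (f a) (f b) == h a b]]].

Definition num_induced (V U : finType) (e : rel V) (h : rel U) : nat :=
  #|[set S : {set V} | induced_iso e h S]|.

Definition complete_graph (m : nat) : rel 'I_m := fun i j => i != j.

Definition complete_bipartite (a b : nat) : rel ('I_a + 'I_b)%type :=
  fun u v => match u, v with
             | inl _, inr _ | inr _, inl _ => true
             | _, _ => false
             end.

(* Simple graphs only for m >= 3, as usual. *)
Definition cycle_graph (m : nat) : rel 'I_m :=
  fun i j => (j == ordS i) || (i == ordS j).

Definition wheel_graph (m : nat) : rel (option 'I_m) :=
  fun u v => match u, v with
             | Some i, Some j => cycle_graph i j
             | None, None => false
             | _, _ => true
             end.

(* a, b, c, d, e are 0, 1, 2, 3, 4. *)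
Definition graph_D : rel 'I_5 :=
  fun i j =>
    let E := [:: (0, 1); (0, 2); (1, 3); (2, 3); (1, 4); (2, 4); (3, 4)]%N in
    ((i : nat, j : nat) \in E) || ((j : nat, i : nat) \in E).

End InducedSubgraphs.

(* Main.v *)
Require Import Defs.
From HB Require Import structures.
From mathcomp Require Import all_boot all_order all_algebra.
From mathcomp Require Import mpoly.
From mathcomp Require Import ring zify.

Set Implicit Arguments.
Unset Strict Implicit.
Unset Printing Implicit Defensive.

Import GRing.Theory.

Local Open Scope ring_scope.

(** Write I for the edge ideal of G, and c(S) for the number of connected
components of the complement of the induced subgraph on S.  Both formulas come
from one description of the linear strand of I, valid for every i > 0:

    beta_(i,i+2)(I) = sum over the sets S of i+2 vertices of (c(S) - 1),

followed by a classification of the graphs on 4 and on 5 vertices.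

Why the linear strand looks like this.  Tor_i(I, k) is computed as well by
resolving k instead of I: it is the homology of the Koszul complex with
coefficients in I.  Passing from one computation to the other is a diagram
chase in the double complex (Koszul complex) (x) F, whose rows and columns are
exact except at their ends; a class is transported along a zigzag
([betti_koszul]).  In total degree i+2 the term of exterior degree i+1 involves
the forms of degree 1 in I and vanishes, so Tor_i(I, k) in degree i+2 is the
kernel of d on the term of exterior degree i with coefficients in the quadratic
part of I.  An element z of this kernel has one coefficient for each set A of i
vertices and each edge pq.  If p or q lies in A the cycle condition kills the
coefficient ([coef2_nonsqfree]).  The others are sorted by S, the union of A and
{p,q}; up to signs, they form a function of the pairs (p,q) in S that vanishes
on non-edges, and the cycle condition says exactly that it is a cocycle
([koszul_cochain]): the coefficient of (p,q) is f(q) - f(p) for some f on S.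
Vanishing on non-edges means that f is constant on the components of the
complement, and f is determined up to a constant, which leaves c(S) - 1
parameters ([betti_linear_strand], [card_strand_basis]).

Why the sum has the stated form.  Call a vertex of S dominating if it is adjacent
to all the others, that is, isolated in the complement.  Choosing v and i+1
of its neighbours amounts to choosing S and a dominating vertex of it, so
the sum over v of the binomials C(deg v, i+1) counts the dominating vertices of
all the sets S ([sum_bin_degree]).  Now c(S) - 1 is the number of dominating
vertices, except that it is one less if the complement has no edge (S is
complete) and one more if the complement has two components with at least two
vertices each.  On 4 vertices such a complement is a pair of disjoint edges, and
S is K_(2,2).  On 5 vertices it consists of two disjoint edges and an isolated
vertex (S is W_4), or of an edge and a triangle (S is K_(2,3)), or of an edge and
a path with three vertices (S is D).  As there are only 2^6 and 2^10 labelled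
graphs, this last classification is settled by evaluating both sides on all of
them ([n_comp_compl4], [n_comp_compl5]). *)

(** * Coefficients of polynomials *)
Section Polynomials.

Variables (k : fieldType) (n : nat).
Local Notation R := {mpoly k[n]}.

Definition mpoly_of (d : nat) (c : 'X_{1..n} -> k) : R :=
  \sum_(m : 'X_{1..n < d}) c m *: 'X_[m].

Lemma mcoeff_mpoly_of d c m :
  (forall m, c m != 0 -> (mdeg m < d)%N) -> (mpoly_of d c)@_m = c m.
Proof.
move=> c_bound; have [lt_md | ge_md] := ltnP (mdeg m) d.
  exact: mcoeff_mpoly.
have -> : c m = 0 by apply/eqP; apply: contraLR ge_md => /c_bound; rewrite ltnNge.
rewrite /mpoly_of raddf_sum big1 //= => [[m' /= lt_m'd]] _.
rewrite mcoeffZ mcoeffX; case: eqP => [E|_]; last by rewrite mulr0.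
by move: lt_m'd; rewrite E ltnNge ge_md.
Qed.

Lemma subUK (x : 'I_n) (m : 'X_{1..n}) : m x != 0%N -> (m - U_(x) + U_(x))%MM = m.
Proof.
by move=> mx; apply/submK/mnm_lepP => i; rewrite mnm1E; case: eqP => // <-; rewrite lt0n.
Qed.

Lemma mcoeffXM (x : 'I_n) (f : R) (m : 'X_{1..n}) :
  ('X_x * f)@_m = if m x == 0%N then 0 else f@_(m - U_(x)).
Proof.
case: eqP => [mx0|/eqP mx]; last first.
  by rewrite -{1}(subUK mx) addmC mulrC mcoeffMX.
apply/eqP; rewrite mcoeff_eq0 mulrC (perm_mem (msuppMX _ _)).
apply/mapP=> -[m' _ E]; move: mx0.
by rewrite E mnmDE mnm1E eqxx.
Qed.

Lemma mdeg_subU (x : 'I_n) (m : 'X_{1..n}) : m x != 0%N -> (mdeg (m - U_(x))).+1 = mdeg m.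
Proof.
by move=> mx; rewrite -addn1 -(mdeg1 x) -mdegD subUK.
Qed.

Lemma mdeg_ge2 (m : 'X_{1..n}) (p q : 'I_n) : m p != 0%N -> m q != 0%N ->
  p != q -> (2 <= mdeg m)%N.
Proof.
move=> mp mq pq; rewrite -(mdeg_subU mp) -(@mdeg_subU q) //.
by rewrite mnmBE mnm1E (negPf pq) subn0.
Qed.

Lemma mdeg2_eq (m : 'X_{1..n}) (p q : 'I_n) : mdeg m = 2 -> m p != 0%N -> m q != 0%N ->
  p != q -> m = (U_(p) + U_(q))%MM.
Proof.
move=> m2 mp mq pq.
have mq' : (m - U_(p))%MM q != 0%N by rewrite mnmBE mnm1E (negPf pq) subn0.
have /eqP : mdeg (m - U_(p) - U_(q)) = 0%N.
  by apply/eqP; rewrite -eqSS (mdeg_subU mq') -eqSS (mdeg_subU mp) m2.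
by rewrite mdeg_eq0 => /eqP m0; rewrite -(subUK mp) -(subUK mq') m0 add0m addmC.
Qed.

Lemma mnm2_neq0 (p q x : 'I_n) :
  ((U_(p) + U_(q))%MM x != 0%N) = (x == p) || (x == q).
Proof.
by rewrite mnmDE !mnm1E addn_eq0 negb_and !eqb0 !negbK (eq_sym p) (eq_sym q).
Qed.

End Polynomials.

(** * The Koszul complex *)
Section Koszul.

Variables (k : fieldType) (n : nat).
Local Notation R := {mpoly k[n]}.

Implicit Types A B : {set 'I_n}.

(** The Koszul complex of the variables, tensored with the free module of rank r:
the value at A is the coefficient of the exterior monomial e_A. *)
Definition chain (r : nat) := {ffun {set 'I_n} -> 'rV[R]_r}.

Definition chmap r s (w : chain r) (D : 'M[R]_(r, s)) : chain s :=
  [ffun A : {set 'I_n} => w A *m D].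

(** [sgn x A] is the sign of the permutation that sorts x followed by A. *)
Definition rank_in (x : 'I_n) (A : {set 'I_n}) : nat := #|[set a in A | a < x]%N|.
Definition sgn (x : 'I_n) (A : {set 'I_n}) : k := (-1) ^+ rank_in x A.

Definition koszul r (w : chain r) : chain r :=
  [ffun A : {set 'I_n} => \sum_(x | x \notin A) (sgn x A *: 'X_x) *: w (x |: A)].

Lemma chmapD r s (w w' : chain r) (D : 'M[R]_(r, s)) :
  chmap (w + w') D = chmap w D + chmap w' D.
Proof. by apply/ffunP=> A; rewrite !ffunE mulmxDl. Qed.

Lemma chmapN r s (w : chain r) (D : 'M[R]_(r, s)) : chmap (- w) D = - chmap w D.
Proof. by apply/ffunP=> A; rewrite !ffunE mulNmx. Qed.

Lemma chmapB r s (w w' : chain r) (D : 'M[R]_(r, s)) :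
  chmap (w - w') D = chmap w D - chmap w' D.
Proof. by rewrite chmapD chmapN. Qed.

Lemma chmap0 r s (D : 'M[R]_(r, s)) : chmap 0 D = 0.
Proof. by apply/ffunP=> A; rewrite !ffunE mul0mx. Qed.

Lemma chmapZ r s (c : R) (w : chain r) (D : 'M[R]_(r, s)) :
  chmap (c *: w) D = c *: chmap w D.
Proof. by apply/ffunP=> A; rewrite !ffunE scalemxAl. Qed.

Lemma koszulD r (w w' : chain r) : koszul (w + w') = koszul w + koszul w'.
Proof.
apply/ffunP=> A; rewrite !ffunE -big_split; apply: eq_bigr => x _.
by rewrite !ffunE scalerDr.
Qed.

Lemma koszulZ r (c : R) (w : chain r) : koszul (c *: w) = c *: koszul w.
Proof.
apply/ffunP=> A; rewrite !ffunE scaler_sumr; apply: eq_bigr => x _.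
by rewrite !ffunE !scalerA mulrC.
Qed.

Lemma koszulN r (w : chain r) : koszul (- w) = - koszul w.
Proof. by rewrite -(scaleN1r w) koszulZ scaleN1r. Qed.

Lemma koszulB r (w w' : chain r) : koszul (w - w') = koszul w - koszul w'.
Proof. by rewrite koszulD koszulN. Qed.

Lemma koszul0 r : koszul (0 : chain r) = 0.
Proof. by rewrite -(scale0r (0 : chain r)) koszulZ !scale0r. Qed.

Lemma koszul_chmap r s (w : chain r) (D : 'M[R]_(r, s)) :
  koszul (chmap w D) = chmap (koszul w) D.
Proof.
apply/ffunP=> A; rewrite !ffunE mulmx_suml; apply: eq_bigr => x _.
by rewrite !ffunE scalemxAl.
Qed.

Lemma mcoeff_koszul r (w : chain r) A b m :
  (koszul w A 0 b)@_m =
  \sum_(x | (x \notin A) && (m x != 0%N))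
     sgn x A * (w (x |: A) 0 b)@_(m - U_(x)).
Proof.
rewrite !ffunE summxE raddf_sum big_mkcondr /=; apply: eq_bigr => x _.
by rewrite mxE -scalerAl mcoeffZ mcoeffXM; case: eqP; rewrite ?mulr0.
Qed.

Lemma rank_inU1 x y (A : {set 'I_n}) :
  y \notin A -> rank_in x (y |: A) = ((y < x) + rank_in x A)%N.
Proof.
move=> yA; rewrite /rank_in.
have [yx|yx] := boolP (y < x)%N; last first.
  apply: eq_card => a; rewrite !inE; case: (eqVneq a y) => [->|] //=.
  by rewrite (negPf yx) andbF.
rewrite (_ : [set a in y |: A | a < x]%N = y |: [set a in A | a < x]%N).
  by rewrite cardsU1 !inE (negPf yA).
apply/setP=> a; rewrite !inE; case: (eqVneq a y) => [->|] //=.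
Qed.

Lemma sgnU1 x y (A : {set 'I_n}) :
  y \notin A -> sgn x (y |: A) = (-1) ^+ (y < x)%N * sgn x A.
Proof. by move=> yA; rewrite /sgn rank_inU1 // exprD. Qed.

Lemma sgn_pm1 x (S : {set 'I_n}) : sgn x S = 1 \/ sgn x S = -1.
Proof. by rewrite /sgn -signr_odd; case: odd; [right | left]. Qed.

Lemma sgnD1 (x y : 'I_n) (S : {set 'I_n}) : y \in S ->
  sgn x (S :\ y) = (-1) ^+ (y < x)%N * sgn x S.
Proof.
move=> yS; rewrite -{2}(setD1K yS) sgnU1 ?setD11 // mulrA -expr2.
by rewrite sqrr_sign mul1r.
Qed.

(** The term for (x, y) cancels the term for (y, x), because inserting x before y
changes just one of the two signs.  Pairing x < y with y < x, rather than
doubling the sum, makes this valid in characteristic 2. *)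
Lemma koszul_koszul r (w : chain r) : koszul (koszul w) = 0.
Proof.
apply/ffunP=> A; rewrite !ffunE.
pose g x y : 'rV[R]_r := (sgn x A *: 'X_x) *:
  ((sgn y (x |: A) *: 'X_y) *: w (y |: (x |: A))).
have gN x y : x \notin A -> y \notin A -> (x < y)%N -> g x y = - g y x.
  move=> xA yA xy; rewrite /g !sgnU1 //.
  rewrite !scalerA setUCA -scaleNr; congr (_ *: _).
  by rewrite xy ltnNge (ltnW xy) mul1r mulN1r scaleNr mulrN mulrC.
transitivity (\sum_(x | x \notin A) \sum_(y | (y \notin A) && (x != y)) g x y).
  apply: eq_bigr => x _; rewrite ffunE scaler_sumr; apply: eq_bigl => y.
  by rewrite !inE negb_or andbC eq_sym.
have split_lt x : \sum_(y | (y \notin A) && (x != y)) g x y =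
    \sum_(y | (y \notin A) && (x < y)%N) g x y +
    \sum_(y | (y \notin A) && (y < x)%N) g x y.
  rewrite (bigID (fun y : 'I_n => (x < y)%N)) /=; congr (_ + _);
    apply: eq_bigl => y; rewrite -val_eqE /=; case: (y \notin A) => //=.
    by case: ltngtP.
  by case: ltngtP.
under eq_bigr => x _ do rewrite split_lt.
rewrite big_split /=.
rewrite [X in _ + X](exchange_big_dep (fun x => x \notin A)) /=; last first.
  by move=> x y _ /andP[].
rewrite -big_split big1 //= => x xA.
rewrite [X in _ + X](eq_bigl (fun y : 'I_n => (y \notin A) && (x < y)%N)) => [|y];
  last by rewrite xA.
rewrite -big_split big1 //= => y /andP[yA xy].
by rewrite gN // addNr.
Qed.

(** Bihomogeneity: w has exterior degree p and total degree j when each variable,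
each e_x, and the b-th basis vector have degrees 1, 1 and [dg b]. *)
Definition graded r (dg : 'I_r -> nat) (p j : nat) (w : chain r) :=
  forall A b m, (w A 0 b)@_m != 0 -> #|A| = p /\ (mdeg m + p + dg b)%N = j.

Section Graded.
Variables (r : nat) (dg : 'I_r -> nat).

Lemma gradedD p j w w' :
  graded dg p j w -> graded dg p j w' -> graded dg p j (w + w').
Proof.
move=> hw hw' A b m; rewrite ffunE mxE mcoeffD.
have [->|nz _] := eqVneq (w A 0 b)@_m 0; last exact: hw.
by rewrite add0r; apply: hw'.
Qed.

Lemma gradedZ p j (c : k) w : graded dg p j w -> graded dg p j (c%:MP *: w).
Proof.
move=> hw A b m; rewrite ffunE mxE mcoeffCM mulf_eq0 => /norP[_].
exact: hw.
Qed.

Lemma gradedN p j w : graded dg p j w -> graded dg p j (- w).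
Proof.
move=> hw A b m; rewrite ffunE mxE mcoeffN oppr_eq0; exact: hw.
Qed.

Lemma gradedB p j w w' :
  graded dg p j w -> graded dg p j w' -> graded dg p j (w - w').
Proof. by move=> hw hw'; apply: gradedD => //; apply: gradedN. Qed.

Lemma graded0 p j : graded dg p j 0.
Proof. by move=> A b m; rewrite ffunE mxE mcoeff0 eqxx. Qed.

Lemma graded_eq0 p j w A : graded dg p j w -> #|A| != p -> w A = 0.
Proof.
move=> hw cA; apply/rowP=> b; apply/mpolyP=> m; rewrite mxE mcoeff0.
by apply/eqP; apply: contraNT cA => /hw[->].
Qed.

Lemma graded_koszul p j w : graded dg p.+1 j w -> graded dg p j (koszul w).
Proof.
move=> hw A b m; rewrite mcoeff_koszul => nz.
have [x /andP[xA mx] {}nz] : exists2 x, (x \notin A) && (m x != 0%N) &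
    (w (x |: A) 0 b)@_(m - U_(x)) != 0.
  apply/exists_inP; apply: contraNT nz => /exists_inPn z.
  apply/eqP/big1 => x Px; move/negPn/eqP: (z x Px) => ->; exact: mulr0.
have [] := hw _ _ _ nz; rewrite cardsU1 xA add1n => -[->] <-; split => //.
by rewrite -(mdeg_subU mx) addnS.
Qed.

Lemma koszul_graded0 j w : graded dg 0 j w -> koszul w = 0.
Proof.
move=> hw; apply/ffunP=> A; rewrite !ffunE big1 // => x xA.
by rewrite (graded_eq0 hw) ?scaler0 // cardsU1 xA.
Qed.

(** The complex splits by multidegree; the multidegree of x^m e_A is the exponent m
plus the indicator of A.  In a nonzero multidegree let x0 be its smallest
variable.  The map that moves x0 from the monomial into the exterior part (and
is 0 if it is there already) is a contracting homotopy, valid in every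
characteristic; no signs occur, since x0 comes first.  Hence a cycle is the
boundary of its image under this map. *)
Lemma koszul_exact p j (w : chain r) : graded dg p j w -> koszul w = 0 ->
    (p = 0%N -> forall b, (w set0 0 b)@_0 = 0) ->
  exists2 y, graded dg p.+1 j y & koszul y = w.
Proof.
move=> hw dw w0.
pose low (x : 'I_n) (A : {set 'I_n}) (m : 'X_{1..n}) :=
  [forall y : 'I_n, (y < x)%N ==> ((y \notin A) && (m y == 0%N))].
(* At most one x contributes: the smallest variable of the multidegree. *)
pose e (A : {set 'I_n}) b m : k := \sum_(x | (x \in A) && low x A m)
   (w (A :\ x) 0 b)@_(m + U_(x)).
have eP A b m : e A b m != 0 -> #|A| = p.+1 /\ (mdeg m + p.+1 + dg b)%N = j.
  move=> nz.
  have [x /andP[xA _] {}nz] : exists2 x, (x \in A) && low x A m &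
      (w (A :\ x) 0 b)@_(m + U_(x)) != 0.
    apply/exists_inP; apply: contraNT nz => /exists_inPn z.
    by apply/eqP/big1 => x Px; move/negPn/eqP: (z x Px).
  have [cA <-] := hw _ _ _ nz; rewrite (cardsD1 x A) xA cA mdegD mdeg1.
  by split => //; rewrite addnS addn1.
pose y : chain r := [ffun A : {set 'I_n} => \row_b mpoly_of j.+1 (e A b)].
have yE A b m : (y A 0 b)@_m = e A b m.
  rewrite ffunE mxE mcoeff_mpoly_of // => m' /eP[_ <-].
  by rewrite ltnS -addnA leq_addr.
exists y => [A b m|]; first by rewrite yE; apply: eP.
apply/ffunP=> A; apply/rowP=> b; apply/mpolyP=> m.
rewrite mcoeff_koszul.
(* The multidegree 0 is where w0 is used. *)
case: (pickP (fun x : 'I_n => (x \in A) || (m x != 0%N))) => [x1 Px1|none]; last first.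
  rewrite big1 => [|x]; last by case/norP: (negbT (none x)) => _ /negPf->; rewrite andbF.
  have -> : A = set0 by apply/setP=> x; rewrite inE; case/norP: (negbT (none x)) => /negPf.
  have -> : m = 0%MM.
    by apply/mnmP=> x; rewrite mnm0E; case/norP: (negbT (none x)) => _ /negPn/eqP.
  have [p0|p0] := eqVneq p 0%N; first by rewrite w0.
  by rewrite (graded_eq0 hw) ?cards0 1?eq_sym // mxE mcoeff0.
have [x0 Px0 x0min] := @arg_minnP _ x1 (fun x : 'I_n => (x \in A) || (m x != 0%N)) val Px1.
have low0 (z : 'I_n) : (z < x0)%N -> (z \notin A) && (m z == 0%N).
  move=> zx; rewrite -[m z == _]negbK -negb_or; apply: contraL zx => /x0min.
  by rewrite -leqNgt.
have eE B (m' : 'X_{1..n}) : (forall z, (z \in B) || (m' z != 0%N) = (z \in A) || (m z != 0%N)) ->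
    e B b m' = if x0 \in B then (w (B :\ x0) 0 b)@_(m' + U_(x0)) else 0.
  move=> supp; rewrite /e.
  have lowE x : x \in B -> low x B m' = (x == x0).
    move=> xB; apply/forallP/eqP => [lx|-> z].
      apply/val_inj/eqP; rewrite eqn_leq; apply/andP; split.
        rewrite leqNgt; apply/negP=> ltx; have := implyP (lx x0) ltx.
        by rewrite -[X in X && _]/(~~ (_ \in _)) -[_ == 0%N]negbK -negb_or supp Px0.
      by apply: x0min; rewrite -supp xB.
    apply/implyP=> /low0; rewrite -[m z == _]negbK -negb_or -supp.
    by rewrite negb_or negbK.
  case: ifP => x0B.
    rewrite (big_pred1 x0) // => x /=; case: (boolP (x \in B)) => /= xB; first exact: lowE.
    by apply/esym/negbTE; apply: contraNneq xB => ->.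
  rewrite big1 // => x /andP[xB]; rewrite lowE // => /eqP E.
  by rewrite -E xB in x0B.
have supp x : (x \notin A) && (m x != 0%N) -> forall z,
    (z \in x |: A) || ((m - U_(x))%MM z != 0%N) = (z \in A) || (m z != 0%N).
  move=> /andP[xA mx] z; rewrite !inE mnmBE mnm1E.
  have [->|zx] := eqVneq z x; first by rewrite mx orbT.
  by rewrite subn0.
under eq_bigr => x Px do rewrite yE (eE _ _ (supp x Px)).
have [x0A|x0A] := boolP (x0 \in A); last first.
  (* Only the term x = x0 survives: no other set x |: A contains x0. *)
  have mx0 : m x0 != 0%N by move: Px0; rewrite (negPf x0A).
  rewrite (bigD1 x0) /= ?x0A // setU11 big1 => [|x]; last first.
    move=> /andP[/andP[xA mx] xx0]; rewrite !inE eq_sym (negPf xx0) (negPf x0A).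
    exact: mulr0.
  rewrite addr0 setU1K // subUK //.
  suff -> : sgn x0 A = 1 by rewrite mul1r.
  rewrite /sgn /rank_in (_ : [set _ in _ | _] = set0) ?cards0 //.
  by apply/setP=> a; rewrite !inE; case: ltnP => [/low0/andP[/negPf->]|]; rewrite ?andbF.
(* Here the cycle condition for w, read at A minus x0 and m plus x0, expresses
   the coefficient of w at (A, m) through the terms of the sum. *)
have : (koszul w (A :\ x0) 0 b)@_(m + U_(x0)) = 0 by rewrite dw ffunE mxE mcoeff0.
rewrite mcoeff_koszul.
rewrite (bigD1 x0) /=; last by rewrite setD11 mnmDE mnm1E eqxx addn1.
rewrite setD1K // addmK.
have sgn0 B : {subset B <= A} -> sgn x0 B = 1.
  move=> sBA; rewrite /sgn /rank_in (_ : [set _ in _ | _] = set0) ?cards0 //.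
  apply/setP=> a; rewrite !inE; case: ltnP => [/low0/andP[/negPf aA _]|]; rewrite ?andbF //.
  by rewrite andbT; apply/negbTE/negP => /sBA; rewrite aA.
rewrite sgn0 ?mul1r; last by move=> a; rewrite !inE => /andP[].
move/eqP; rewrite addr_eq0 => /eqP ->; rewrite -sumrN.
apply: eq_big => [x|x /andP[xA mx]].
  rewrite !inE mnmDE mnm1E (eq_sym x0).
  by have [->|xx0] /= := eqVneq x x0; rewrite ?andbF ?addn0 ?andbT ?x0A.
have xx0 : x != x0 by apply: contraNneq xA => ->.
rewrite !inE x0A orbT -mulNr; congr (_ * (w _ 0 b)@_(_)).
- have {1}-> : A = x0 |: (A :\ x0) by rewrite setD1K.
  rewrite sgnU1 ?setD11 // (_ : (x0 < x)%N) ?mulN1r //.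
  rewrite ltn_neqAle eq_sym xx0 x0min // mx; exact: orbT.
- apply/mnmP=> z; rewrite !(mnmDE, mnmBE, mnm1E).
  have [<-|] := eqVneq x z; last by rewrite !subn0.
  by rewrite eq_sym (negPf xx0) !addn0.
apply/setP=> z; rewrite !inE.
by have [->|zx] := eqVneq z x; rewrite ?xx0.
Qed.

End Graded.

End Koszul.

(** * Homogeneous lifts *)
Section GradedLift.

Variables (k : fieldType) (n r s : nat).
Local Notation R := {mpoly k[n]}.
Variables (dgr : 'I_r -> nat) (dgs : 'I_s -> nat) (D : 'M[R]_(r, s)).
Hypothesis D_graded : forall a b m, m \in msupp (D a b) ->
  (mdeg m + dgs b)%N = dgr a.

Let coef_D a b m : (D a b)@_m != 0 -> (mdeg m + dgs b)%N = dgr a.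
Proof. by rewrite -mcoeff_msupp; apply: D_graded. Qed.

Lemma graded_chmap p j w :
  graded dgr p j w -> graded dgs p j (chmap w D).
Proof.
move=> hw A b m nz.
have [a {}nz] : exists a, (w A 0 a * D a b)@_m != 0.
  apply/existsP; apply: contraNT nz => /existsPn z.
  rewrite ffunE mxE raddf_sum big1 //= => a _.
  by move/negPn/eqP: (z a).
have [h mE {}nz] : exists2 h : 'X_{1..n < (mdeg m).+1, (mdeg m).+1},
    m == (h.1 + h.2)%MM & (w A 0 a)@_h.1 * (D a b)@_h.2 != 0.
  apply/exists_inP; apply: contraNT nz => /exists_inPn z.
  by rewrite mcoeffM big1 // => h Ph; move/negPn/eqP: (z h Ph).
case: h mE nz => -[h1 ?] [h2 ?] /= /eqP ->.
rewrite mulf_eq0 => /norP[/hw[cA <-] /coef_D <-]; split=> //.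
by rewrite mdegD -!addnA; congr addn; rewrite addnCA.
Qed.

(** A map of degree 0 commutes with taking homogeneous components, so the component
of y of the right degree is as good a lift as y itself. *)
Lemma graded_lift p j y : graded dgs p j (chmap y D) ->
  exists2 y', graded dgr p j y' & chmap y' D = chmap y D.
Proof.
move=> hyD.
pose c (A : {set 'I_n}) a m : k :=
  if (#|A| == p) && (mdeg m + p + dgr a == j)%N then (y A 0 a)@_m else 0.
pose y' : chain k n r :=
  [ffun A : {set 'I_n} => \row_a mpoly_of (msize (y A 0 a)) (c A a)].
have y'E A a m : (y' A 0 a)@_m = c A a m.
  rewrite ffunE mxE mcoeff_mpoly_of // => m'; rewrite /c.
  case: ifP => _; last by rewrite eqxx.
  by rewrite -mcoeff_msupp => /msize_mdeg_lt.
exists y'; move: y' y'E => y' y'E.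
  by move=> A a m; rewrite y'E /c; case: ifP; rewrite ?eqxx // => /andP[/eqP? /eqP].
apply/ffunP=> A; apply/rowP=> b; apply/mpolyP=> m.
pose ok := (#|A| == p) && (mdeg m + p + dgs b == j)%N.
have termE a (h1 h2 : 'X_{1..n}) : m = (h1 + h2)%MM ->
    c A a h1 * (D a b)@_h2 = if ok then (y A 0 a)@_h1 * (D a b)@_h2 else 0.
  move=> mE; have [->|/coef_D Dh] := eqVneq ((D a b)@_h2) 0.
    by rewrite !mulr0 if_same.
  rewrite /c /ok mE mdegD -Dh [(mdeg h1 + mdeg h2 + p)%N]addnAC -addnA.
  by rewrite !addnA; case: ifP; rewrite ?mul0r.
have [okT|okF] := boolP ok.
  rewrite !ffunE !mxE !raddf_sum; apply: eq_bigr => a _ /=.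
  rewrite !mcoeffM; apply: eq_bigr => h /eqP mE.
  by rewrite y'E (termE _ _ _ mE) okT.
have -> : (chmap y D A 0 b)@_m = 0.
  apply/eqP; apply: contraNT okF => /hyD[/eqP cA /eqP jE].
  by rewrite /ok cA.
rewrite ffunE mxE raddf_sum big1 //= => a _.
rewrite mcoeffM big1 // => h /eqP mE.
by rewrite y'E (termE _ _ _ mE) (negPf okF).
Qed.

End GradedLift.

(** * Zigzags between a resolution and the Koszul complex *)
Section Zigzag.

Variables (k : fieldType) (n : nat).
Local Notation R := {mpoly k[n]}.
Variables (I : R -> Prop) (F : graded_free_resolution I).

(** Putting the augmentation F_0 -> R in the same sequence as the maps of the
resolution shifts the indices by one, but spares a separate treatment of the
bottom of the resolution: this complex is exact at all its terms but R. *)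
Definition arank q : nat := if q is q'.+1 then res_rank F q' else 1%N.

Definition adeg q : 'I_(arank q) -> nat :=
  match q with 0 => fun=> 0%N | q'.+1 => @res_deg _ _ _ F q' end.

Definition adiff q : 'M[R]_(arank q.+1, arank q) :=
  match q with 0 => res_aug F | q'.+1 => res_diff F q' end.

Lemma adiff_graded q a b m : m \in msupp (adiff q a b) ->
  (mdeg m + adeg b)%N = adeg a.
Proof.
by case: q a b => [|q] a b /=; [rewrite addn0; apply: res_aug_homog | apply: res_diff_homog].
Qed.

Lemma adiff_exact q (v : 'rV[R]_(arank q.+1)) :
  v *m adiff q = 0 <-> exists w, v = w *m adiff q.+1.
Proof. by case: q v => [|q] v; [apply: res_exact0 | apply: res_exact]. Qed.

Lemma chmap_adiff q (w : chain k n (arank q.+2)) :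
  chmap (chmap w (adiff q.+1)) (adiff q) = 0.
Proof.
apply/ffunP=> A; rewrite !ffunE; apply/adiff_exact.
by exists (w A).
Qed.

Lemma chmap_exact q p j (w : chain k n (arank q.+1)) :
  graded (@adeg q.+1) p j w -> chmap w (adiff q) = 0 ->
  exists2 y, graded (@adeg q.+2) p j y & w = chmap y (adiff q.+1).
Proof.
move=> hw wD.
have /fin_all_exists[y yP] (A : {set 'I_n}) :
    exists v, w A = v *m adiff q.+1.
  by apply/adiff_exact; move/ffunP/(_ A): wD; rewrite !ffunE.
have E : chmap [ffun A => y A] (adiff q.+1) = w.
  by apply/ffunP=> A; rewrite !ffunE -yP.
rewrite -E in hw.
have [y' hy' y'E] := graded_lift (@adiff_graded q.+1) hw.
by exists y' => //; rewrite y'E.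
Qed.

Definition ideal_chain p j (z : chain k n 1) :=
  graded (fun=> 0%N) p j z /\ forall A, I (z A 0 0).

Lemma ideal_chainP p j (z : chain k n 1) :
  ideal_chain p j z <->
  exists2 w, graded (@adeg 1) p j w & z = chmap w (adiff 0).
Proof.
split=> [[hz zI]|[w hw ->]]; last first.
  split; first exact: (graded_chmap (@adiff_graded 0)).
  by move=> A; rewrite ffunE; apply/(res_aug_image F); exists (w A).
have /fin_all_exists[y yP] (A : {set 'I_n}) :
    exists v : 'rV[R]_(arank 1), z A 0 0 = (v *m adiff 0) 0 0.
  by have /(res_aug_image F) := zI A.
have E : chmap [ffun A => y A] (adiff 0) = z.
  apply/ffunP=> A; rewrite !ffunE; apply/rowP=> b.
  by rewrite !ord1 -yP.
rewrite -E in hz.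
have [y' hy' yE] := graded_lift (@adiff_graded 0) hz.
by exists y'; rewrite ?yE.
Qed.

(** A path in the double complex (Koszul complex) (x) F, from exterior degree p
over F_q to exterior degree p + q over I: go down by the resolution, lift back
along the Koszul differential, and so on, ending with the augmentation. *)
Fixpoint zigzag p j q : chain k n (arank q.+1) -> chain k n 1 -> Prop :=
  match q with
  | 0 => fun w z => z = chmap w (adiff 0)
  | q'.+1 => fun w z => exists w', [/\ graded (@adeg q'.+1) p.+1 j w',
      koszul w' = chmap w (adiff q'.+1) & zigzag p.+1 j w' z]
  end.

Lemma zigzag_lin p j q c w1 w2 z1 z2 :
  @zigzag p j q w1 z1 -> @zigzag p j q w2 z2 ->
  @zigzag p j q (c%:MP *: w1 + w2) (c%:MP *: z1 + z2).
Proof.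
elim: q p w1 w2 => [|q IHq] p w1 w2 /=; first by rewrite chmapD chmapZ => -> ->.
move=> [w1' [h1 d1 z1']] [w2' [h2 d2 z2']]; exists (c%:MP *: w1' + w2'); split.
- by apply: gradedD => //; apply: gradedZ.
- by rewrite koszulD koszulZ chmapD chmapZ d1 d2.
- exact: IHq.
Qed.

Lemma zigzag0 p j q : @zigzag p j q 0 0.
Proof.
elim: q p => [|q IHq] p /=; first by rewrite chmap0.
by exists 0; split; [apply: graded0 | rewrite koszul0 chmap0 | apply: IHq].
Qed.

Lemma zigzag_ideal p j q w z : graded (@adeg q.+1) p j w -> zigzag p j w z ->
  ideal_chain (p + q) j z.
Proof.
elim: q p w => [|q IHq] p w /= hw; first by move=> zE; apply/ideal_chainP; exists w; rewrite ?addn0.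
by case=> w' [hw' _ /(IHq _ _ hw')]; rewrite addSnnS.
Qed.

(** Along the zigzag, the image of a lift is again a Koszul cycle, because d and the
differential of F commute; so the next lift exists by [koszul_exact].  Constants
can obstruct this only at exterior degree 0, hence at the first step. *)
Lemma zigzag_exists p j q (w : chain k n (arank q.+1)) :
  graded (@adeg q.+1) p j w -> koszul (chmap w (adiff q)) = 0 ->
  (p = 0%N -> forall b, (chmap w (adiff q) set0 0 b)@_0 = 0) ->
  exists2 z, zigzag p j w z & koszul z = 0.
Proof.
elim: q p w => [|q IHq] p w hw dw w0; first by exists (chmap w (adiff 0)).
have [w' hw' dw'] := koszul_exact (graded_chmap (@adiff_graded q.+1) hw) dw w0.
have dw'D : koszul (chmap w' (adiff q)) = 0.
  by rewrite koszul_chmap dw' chmap_adiff.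
have [//|z zz dz] := IHq p.+1 w' hw' dw'D.
by exists z => //=; exists w'.
Qed.

(** The same path, walked backwards with the exactness of F. *)
Lemma zigzag_surj p j q (z : chain k n 1) :
  ideal_chain (p + q) j z -> koszul z = 0 ->
  exists w, [/\ graded (@adeg q.+1) p j w, chmap (koszul w) (adiff q) = 0 &
     @zigzag p j q w z].
Proof.
elim: q p => [|q IHq] p hz dz.
  rewrite addn0 in hz; have [w hw zE] := (ideal_chainP _ _ _).1 hz.
  by exists w; split; rewrite // -koszul_chmap -zE.
rewrite -addSnnS in hz; have [w' [hw' dw' zz]] := IHq p.+1 hz dz.
have [w hw wE] := chmap_exact (graded_koszul hw') dw'.
exists w; split=> //; last by exists w'.
by rewrite -koszul_chmap -wE koszul_koszul.
Qed.

(** The end of a zigzag depends on the choices only up to boundaries: the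
difference of the first lift and of u' D is a Koszul cycle, hence a boundary,
and the next step starts from an element of the same shape. *)
Lemma zigzag_of_boundary p j q u u' z :
  graded (@adeg q.+2) p j u -> graded (@adeg q.+1) p.+1 j u' ->
  zigzag p j (chmap u (adiff q.+1) + koszul u') z ->
  exists2 y, ideal_chain (p + q).+1 j y & z = koszul y.
Proof.
elim: q p u u' => [|q IHq] p u u' hu hu'.
  rewrite [zigzag _ _ _ _]/= chmapD chmap_adiff add0r -koszul_chmap => ->.
  exists (chmap u' (adiff 0)) => //.
  by apply/ideal_chainP; exists u'; rewrite ?addn0.
case=> w' [hw' dw' zz].
have d0 : koszul (w' - chmap u' (adiff q.+1)) = 0.
  by rewrite koszulB dw' koszul_chmap chmapD chmap_adiff add0r subrr.
have h0 := gradedB hw' (graded_chmap (@adiff_graded q.+1) hu').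
have [//|u'' hu'' du''] := koszul_exact h0 d0.
have := IHq p.+1 u' u'' hu' hu''.
by rewrite du'' addrC subrK addSnnS; apply.
Qed.

(** The converse of [zigzag_of_boundary], by the same chase with the exactness of F
in place of that of the Koszul complex: this is the injectivity of the
transport of homology classes. *)
Lemma boundary_of_zigzag p j q w y :
  graded (@adeg q.+1) p j w -> ideal_chain (p + q).+1 j y ->
  zigzag p j w (koszul y) ->
  exists u u', [/\ graded (@adeg q.+2) p j u, graded (@adeg q.+1) p.+1 j u' &
    w = chmap u (adiff q.+1) + koszul u'].
Proof.
elim: q p w => [|q IHq] p w hw hy.
  rewrite addn0 in hy.
  have [y' hy' yE] := (ideal_chainP _ _ _).1 hy.
  rewrite [zigzag _ _ _ _]/= => E.
  have E' : chmap (w - koszul y') (adiff 0) = 0.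
    by rewrite chmapB -koszul_chmap -yE E subrr.
  have [u hu uE] := chmap_exact (gradedB hw (graded_koszul hy')) E'.
  by exists u, y'; split; rewrite // -uE subrK.
case=> w' [hw' dw' zz]; rewrite -addSnnS in hy.
have [u' [u'' [hu' hu'' w'E]]] := IHq _ _ hw' hy zz.
have E' : chmap (w - koszul u') (adiff q.+1) = 0.
  by rewrite chmapB -koszul_chmap -dw' w'E koszulD koszul_koszul addr0 subrr.
have [u hu uE] := chmap_exact (gradedB hw (graded_koszul hu')) E'.
by exists u, u'; split; rewrite // -uE subrK.
Qed.

End Zigzag.

(** * Constant chains *)
Section ConstantChains.

Variables (k : fieldType) (n r : nat).
Local Notation R := {mpoly k[n]}.
Implicit Types (v : 'rV[k]_r) (w : chain k n r).

Definition cst v : chain k n r :=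
  [ffun A : {set 'I_n} => if A == set0 then map_mx (@mpolyC n k) v else 0].

Definition const_part w : 'rV[k]_r := map_mx (mcoeff 0%MM) (w set0).

Lemma cst_lin c v v' : cst (c *: v + v') = c%:MP *: cst v + cst v'.
Proof.
apply/ffunP=> A; rewrite !ffunE; case: eqP => _; last by rewrite scaler0 addr0.
by apply/rowP=> b; rewrite !mxE mpolyCD mpolyCM.
Qed.

Lemma cst0 : cst 0 = 0.
Proof.
by apply/ffunP=> A; rewrite !ffunE; case: eqP => // _; apply/rowP=> b; rewrite !mxE mpolyC0.
Qed.

Lemma const_part_cst v : const_part (cst v) = v.
Proof. by apply/rowP=> b; rewrite !mxE ffunE eqxx mxE mcoeffC eqxx mulr1. Qed.

Lemma const_partD w w' : const_part (w + w') = const_part w + const_part w'.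
Proof. by apply/rowP=> b; rewrite !mxE ffunE mxE mcoeffD. Qed.

Lemma const_partN w : const_part (- w) = - const_part w.
Proof. by apply/rowP=> b; rewrite !mxE ffunE mxE mcoeffN. Qed.

Lemma const_part_koszul w : const_part (koszul w) = 0.
Proof.
apply/rowP=> b; rewrite !mxE mcoeff_koszul big1 // => x.
by rewrite mnm0E eqxx andbF.
Qed.

Lemma graded_cst (dg : 'I_r -> nat) j v :
  (forall b, v 0 b != 0 -> dg b = j) -> graded dg 0 j (cst v).
Proof.
move=> hv A b m; rewrite ffunE; case: (A =P set0) => [->|_]; last by rewrite mxE mcoeff0 eqxx.
rewrite mxE mcoeffC cards0; have [->|_] := eqVneq m 0%MM; last by rewrite mulr0 eqxx.
by rewrite mulr1 mdeg0 => /hv <-.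
Qed.

Lemma graded_const_part (dg : 'I_r -> nat) j w :
  graded dg 0 j w -> forall b, const_part w 0 b != 0 -> dg b = j.
Proof. by move=> hw b; rewrite mxE => /hw[_]; rewrite mdeg0. Qed.

(** A chain of exterior degree 0 whose coefficients are in the ideal of the
variables is a boundary: F (x) k is the cokernel of the Koszul differential. *)
Lemma koszul_of_const_part0 (dg : 'I_r -> nat) j w :
  graded dg 0 j w -> const_part w = 0 ->
  exists2 u, graded dg 1 j u & koszul u = w.
Proof.
move=> hw w0; apply: (koszul_exact hw); first exact: koszul_graded0 hw.
by move=> _ b; move/rowP/(_ b): w0; rewrite !mxE.
Qed.

End ConstantChains.

Lemma const_part_chmap (k : fieldType) n r s (w : chain k n r)
    (D : 'M[{mpoly k[n]}]_(r, s)) :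
  const_part (chmap w D) = const_part w *m map_mx (mcoeff 0%MM) D.
Proof. by rewrite /const_part ffunE map_mxM. Qed.

(** * Betti numbers as Koszul homology *)
Section TorBalance.

Variables (k : fieldType) (n : nat).
Local Notation R := {mpoly k[n]}.
Variables (I : R -> Prop) (F : graded_free_resolution I).

Lemma chainsP i j (v : 'rV[k]_(res_rank F i)) :
  reflect (forall b, v 0 b != 0 -> @res_deg _ _ _ F i b = j) (v <= chains F i j)%MS.
Proof.
apply: (iffP submxP) => [[u ->] b|hv].
  rewrite mul_mx_diag !mxE; case: (_ =P j) => // _.
  by rewrite mulr0 eqxx.
exists v; rewrite mul_mx_diag; apply/rowP=> b; rewrite !mxE.
have [->|/hv ->] := eqVneq (v 0 b) 0; first by rewrite mul0r.
by rewrite eqxx mulr1.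
Qed.

Variables (i j N : nat) (read : chain k n 1 -> 'rV[k]_N).

(** [read] identifies the Koszul homology with coefficients in I with the space of
row vectors of length N. *)
Hypothesis read_lin : forall c z z',
  read (c%:MP *: z + z') = c *: read z + read z'.
Hypothesis read_ker : forall z, ideal_chain I i.+1 j z -> koszul z = 0 ->
  (read z = 0 <-> exists2 y, ideal_chain I i.+2 j y & z = koszul y).
Hypothesis read_onto : forall g,
  exists z, [/\ ideal_chain I i.+1 j z, koszul z = 0 & read z = g].

(** Tor is balanced.  Transporting the constant cycles of F (x) k along zigzags and
reading off the coordinates of the ends gives a matrix M whose kernel consists
of the boundaries and whose image is everything, so that its rank is at the
same time N and the Betti number. *)
Theorem betti_koszul : betti F i.+1 j = N.
Proof.
pose C := cycles F i.+1 j; pose B := boundaries F i.+1 j.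
pose r := res_rank F i.+1.
have CP (v : 'rV[k]_r) : (v <= C)%MS ->
    graded (@adeg _ _ _ F i.+2) 0 j (cst n v) /\ v *m res_diffk F i = 0.
  by rewrite sub_capmx => /andP[/chainsP hv /sub_kermxP]; split => //; apply: graded_cst.
(* A zigzag is chosen for each generator of the space of cycles only; linear
   combinations of these serve for all the other cycles. *)
have /fin_all_exists[zs zsP] (a : 'I_r) : exists z,
    @zigzag _ _ _ F 0 j i.+1 (cst n (row a C)) z /\ koszul z = 0.
  have [h0 hD] := CP _ (row_sub a C).
  have h1 := graded_chmap (@adiff_graded _ _ _ F i.+1) h0.
  have [||z zz dz] := @zigzag_exists _ _ _ F 0 j i.+1 _ h0.
  - exact: koszul_graded0 h1.
  - move=> _ b; have /rowP/(_ b) := hD.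
    rewrite -[row a C in X in X -> _](const_part_cst n) -const_part_chmap.
    by rewrite !mxE.
  by exists z.
pose Z (u : 'rV[k]_r) := \sum_a (u 0 a)%:MP *: zs a.
pose M := \matrix_a read (zs a).
have read0 : read 0 = 0.
  have := read_lin 1 0 0; rewrite scaler0 addr0 scale1r => /eqP.
  by rewrite -subr_eq0 opprD addNKr oppr_eq0 => /eqP.
have ZP u : [/\ @zigzag _ _ _ F 0 j i.+1 (cst n (u *m C)) (Z u), koszul (Z u) = 0
    & read (Z u) = u *m M].
  rewrite mulmx_sum_row [u *m M]mulmx_sum_row /Z.
  elim: (index_enum _) => [|a s [IH1 IH2 IH3]].
    by rewrite !big_nil cst0 koszul0; split=> //; apply: zigzag0.
  have [h1 h2] := zsP a; rewrite !big_cons; split.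
  - by rewrite cst_lin; apply: zigzag_lin.
  - by rewrite koszulD koszulZ h2 IH2 scaler0 addr0.
  by rewrite read_lin IH3 rowK.
have Zideal u : ideal_chain I i.+1 j (Z u).
  have [zz _ _] := ZP u; have [h0 _] := CP _ (submxMl u C).
  exact: zigzag_ideal h0 zz.
have MkerP (u : 'rV[k]_r) : (u *m M == 0) = (u *m C <= B)%MS.
  have [zz dz rE] := ZP u; have [h0 hD] := CP _ (submxMl u C).
  apply/eqP/idP => [uM0|/submxP[y0 yE]].
    have [y hy yE] := (read_ker (Zideal u) dz).1 (etrans rE uM0).
    rewrite yE in zz.
    have [U [u' [hU _ uE]]] := boundary_of_zigzag h0 hy zz.
    have -> : u *m C = const_part U *m res_diffk F i.+1.
      rewrite -[LHS](const_part_cst n) uE const_partD const_part_koszul addr0.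
      exact: const_part_chmap.
    by apply: submxMr; apply/chainsP; apply: graded_const_part hU.
  have hy0 : graded (@adeg _ _ _ F i.+3) 0 j (cst n (y0 *m chains F i.+2 j)).
    by apply: graded_cst; apply/chainsP; apply: submxMl.
  have hy1 := gradedB (graded_chmap (@adiff_graded _ _ _ F i.+2) hy0) h0.
  have [|u' hu' u'E] := koszul_of_const_part0 hy1.
    rewrite const_partD const_partN const_part_chmap !const_part_cst.
    by rewrite yE mulmxA subrr.
  have [] := @zigzag_of_boundary _ _ _ F 0 j i.+1 _ (- u') (Z u) hy0 (gradedN hu').
    by rewrite koszulN u'E opprB addrC subrK.
  move=> y hy ZE; rewrite -rE; apply/(read_ker (Zideal u) dz).
  by exists y.
have Mfull (g : 'rV[k]_N) : exists u, u *m M = g.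
  have [z [hz dz <-]] := read_onto g.
  have [w [hw _ zz]] := @zigzag_surj _ _ _ F 0 j i.+1 z hz dz.
  have wC : (const_part w <= C)%MS.
    rewrite sub_capmx; apply/andP; split.
      by apply/chainsP; apply: graded_const_part hw.
    apply/sub_kermxP; have [w' [_ dw' _]] := zz.
    by rewrite -[LHS](const_part_chmap w (res_diff F i)) -dw' const_part_koszul.
  (* w and its constant part differ by a Koszul boundary, which does not matter
     for the end of the zigzag. *)
  have [u uE] := submxP wC; exists u.
  have [zu dzu <-] := ZP u; have [h0 _] := CP _ (submxMl u C).
  have hw0 := gradedD (gradedZ (c := -1) h0) hw.
  have [|u' hu' u'E] := koszul_of_const_part0 hw0.
    rewrite mpolyCN scaleN1r const_partD const_partN const_part_cst uE.
    exact: addNr.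
  have zz' := zigzag_lin (-1) zu zz; have hz' := zigzag_ideal hw0 zz'.
  rewrite -u'E in zz'.
  have h00 : graded (@adeg _ _ _ F i.+3) 0 j (0 : chain k n _) by exact: graded0.
  have [] := @zigzag_of_boundary _ _ _ F 0 j i.+1 0 u' ((-1)%:MP *: Z u + z) h00 hu'.
    by rewrite chmap0 add0r.
  move=> y hy ZE; have := read_lin (-1) (Z u) z.
  have -> : read ((-1)%:MP *: Z u + z) = 0.
    apply/read_ker; last by exists y.
      exact: hz'.
    by rewrite ZE koszul_koszul.
  by move/eqP; rewrite scaleN1r eq_sym addrC subr_eq0 => /eqP.
have rankM : \rank M = N.
  apply/eqP; rewrite -[_ == N]/(row_full M) -sub1mx; apply/row_subP=> t.
  by have [u <-] := Mfull (row t 1%:M); apply: submxMl.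
(* Multiplying by cokermx B is reducing modulo the boundaries. *)
have kerE : (kermx M :=: kermx (C *m cokermx B))%MS.
  apply/eqmxP/andP; split; apply/rV_subP=> u.
    move/sub_kermxP/eqP; rewrite MkerP submxE -mulmxA => /eqP uB.
    exact/sub_kermxP.
  by move/sub_kermxP/eqP; rewrite mulmxA -submxE -MkerP => /eqP/sub_kermxP.
have capE : (C :&: kermx (cokermx B) :=: B)%MS.
  apply/eqmxP/andP; split.
    apply/rV_subP=> u; rewrite sub_capmx => /andP[_ /sub_kermxP/eqP].
    by rewrite -submxE.
  rewrite sub_capmx boundaries_sub_cycles /=.
  by apply/sub_kermxP/eqP; rewrite -submxE.
rewrite /betti -/C -/B -rankM -(mxrank_mul_ker C (cokermx B)) capE addnK.
apply/eqP; rewrite -(eqn_add2l (\rank (kermx M))) {1}kerE !mxrank_ker.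
by rewrite !subnK // rank_leq_row.
Qed.

End TorBalance.

(** * Quadratic Koszul chains as cochains *)
Section Cochains.

Variables (k : fieldType) (n : nat).
Local Notation coef2 z A p q := ((z A 0 0)@_(U_(p) + U_(q))).

(** For each S, the signs turn the coefficients of z at x_p x_q e_(S - p - q) into an
alternating function of (p, q), a 1-cochain of the full simplex on S. *)
Definition cochain (z : chain k n 1) (S : {set 'I_n}) (p q : 'I_n) : k :=
  sgn k p S * sgn k q S * (-1) ^+ (p < q)%N * coef2 z (S :\ p :\ q) p q.

Lemma cochain_antisym z S p q : p != q -> cochain z S p q = - cochain z S q p.
Proof.
move=> pq; rewrite /cochain.
have -> : S :\ p :\ q = S :\ q :\ p by apply/setP=> x; rewrite !inE andbCA.
rewrite [(U_(p) + _)%MM]addmC [sgn k q S * _]mulrC -mulNr; congr (_ * _).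
rewrite -mulrN; congr (_ * _).
by case: (ltngtP p q) pq => [||/val_inj->]; rewrite ?eqxx // expr0 expr1 ?opprK.
Qed.

(** Only p, q and r can be moved from the monomial x_p x_q x_r into the exterior
part, so the coefficient on the left has three terms; up to a common sign
they are the terms of the coboundary of the cochain on the triangle pqr. *)
Lemma koszul_cochain z (S : {set 'I_n}) p q r : p \in S -> q \in S -> r \in S ->
  p != q -> q != r -> r != p ->
  exists2 c : k, c != 0 &
  (koszul z (S :\ p :\ q :\ r) 0 0)@_(U_(p) + U_(q) + U_(r)) =
  c * (cochain z S p q + cochain z S q r + cochain z S r p).
Proof.
move=> pS qS rS pq qr rp.
pose ep := ((-1) ^+ (p < q)%N * (-1) ^+ (q < r)%N * (-1) ^+ (r < p)%N : k).
exists (- (ep * (sgn k p S * sgn k q S * sgn k r S))).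
  by rewrite oppr_eq0 !mulf_eq0 !signr_eq0.
have [qp rq pr] : [/\ q != p, r != q & p != r].
  by rewrite (eq_sym q) (eq_sym r q) (eq_sym p r).
have mE x : ((U_(p) + U_(q) + U_(r))%MM x != 0%N) = [|| x == p, x == q | x == r].
  by rewrite mnmDE addn_eq0 negb_and mnm2_neq0 mnm1E eqb0 negbK (eq_sym r) orbA.
rewrite mcoeff_koszul (bigD1 p) /=; last by rewrite mE !inE !eqxx !andbF.
rewrite (bigD1 q) /=; last by rewrite mE !inE !eqxx !orbT qp andbF.
rewrite (bigD1 r) /=; last by rewrite mE !inE !eqxx !orbT rp rq.
rewrite big1 => [|x]; last first.
  by rewrite mE => /andP[/andP[/andP[/andP[_ /or3P[]->]]]].
rewrite addr0; rewrite !sgnD1 ?inE ?pS ?qS ?rS ?pq ?qr ?rp ?qp ?rq ?pr //.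
have setE x y w : x \in S -> x != y -> x != w -> x |: (S :\ x :\ y :\ w) = S :\ y :\ w.
  move=> xS xy xw; apply/setP=> t; rewrite !inE.
  by case: (eqVneq t x) => [->|] //=; rewrite xS xy xw.
have setC x y (B : {set 'I_n}) : B :\ x :\ y = B :\ y :\ x.
  by apply/setP=> t; rewrite !inE andbCA.
have -> : p |: S :\ p :\ q :\ r = S :\ q :\ r by apply: setE.
have -> : q |: S :\ p :\ q :\ r = S :\ r :\ p by rewrite (setC p q) setE // setC.
have -> : r |: S :\ p :\ q :\ r = S :\ p :\ q.
  by rewrite (setC q r) (setC p r) setE.
have -> : (U_(p) + U_(q) + U_(r) - U_(p))%MM = (U_(q) + U_(r))%MM.
  by rewrite -addmA addmC addmK.
have -> : (U_(p) + U_(q) + U_(r) - U_(q))%MM = (U_(r) + U_(p))%MM.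
  by rewrite [(U_(p) + _)%MM]addmC -addmA addmC addmK addmC.
rewrite addmK /cochain /ep !ltnn.
have ltC (x y : 'I_n) : x != y -> (y < x)%N = ~~ (x < y)%N.
  by move=> xy; rewrite -leqNgt ltn_neqAle val_eqE eq_sym xy.
rewrite (ltC _ _ pq) (ltC _ _ qr) (ltC _ _ rp).
case: (sgn_pm1 k p S) => ->; case: (sgn_pm1 k q S) => ->; case: (sgn_pm1 k r S) => ->;
case: (p < q)%N; case: (q < r)%N; case: (r < p)%N; rewrite /= ?expr0 ?expr1; ring.
Qed.

End Cochains.

(** * Quadratic forms in an edge ideal *)
Section EdgeIdeal.

Variables (k : fieldType) (n : nat) (e : rel 'I_n).
Hypotheses (e_sym : ssrbool.symmetric e) (e_irr : irreflexive e).
Local Notation R := {mpoly k[n]}.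
Local Notation I := (@edge_ideal k n e).
Local Notation coef2 z A p q := ((z A 0 0)@_(U_(p) + U_(q))).

Lemma edge_neq p q : e p q -> p != q.
Proof. by apply: contraTneq => ->; rewrite e_irr. Qed.

Lemma edge_ideal_msupp (f : R) m : I f -> f@_m != 0 ->
  exists p q, [/\ e p q, m p != 0%N & m q != 0%N].
Proof.
move=> [N [c [s [hs ->]]]] nz.
have [t {}nz] : exists t, (c t * s t)@_m != 0.
  apply/existsP; apply: contraNT nz => /existsPn z.
  by rewrite raddf_sum big1 //= => t _; move/negPn/eqP: (z t).
have [p [q [epq sE]]] := hs t; exists p, q; split=> //.
  by apply: contraNneq nz => mp; rewrite sE mulrC -mulrA mcoeffXM mp.
apply: contraNneq nz => mq.
by rewrite sE mulrC ['X_p * _]mulrC -mulrA mcoeffXM mq.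
Qed.

Lemma edge_ideal_mdeg2 (f : R) :
  (forall m, f@_m != 0 -> exists p q, e p q /\ m = (U_(p) + U_(q))%MM) -> I f.
Proof.
move=> hf; pose s := msupp f.
exists (size s), (fun t => (f@_(nth 0%MM s t))%:MP), (fun t => 'X_[nth 0%MM s t]).
split=> [t|].
  have /hf[p [q [epq ->]]] : f@_(nth 0%MM s t) != 0.
    by rewrite -mcoeff_msupp mem_nth.
  by exists p, q; rewrite mpolyXD.
rewrite {1}[f]mpolyE (big_nth 0%MM) big_mkord; apply: eq_bigr => t _.
by rewrite mul_mpolyC.
Qed.

Lemma coef2_nonedge (z : chain k n 1) A p q :
  I (z A 0 0) -> ~~ e p q -> coef2 z A p q = 0.
Proof.
move=> zI; apply: contraNeq => /(edge_ideal_msupp zI)[a [b []]].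
by rewrite !mnm2_neq0 => eab /orP[] /eqP aE /orP[] /eqP bE; move: eab;
  rewrite aE bE ?e_irr // e_sym.
Qed.

Lemma ideal_chain_mdeg_gt2 i (y : chain k n 1) : ideal_chain I i.+2 i.+3 y -> y = 0.
Proof.
move=> [hy yI]; apply/ffunP=> A; apply/rowP=> b; rewrite ord1 ffunE mxE.
apply/mpolyP=> m; rewrite mcoeff0; apply/eqP/negPn/negP=> nz.
have [p [q [epq mp mq]]] := edge_ideal_msupp (yI A) nz.
have [_] := hy _ _ _ nz; have := mdeg_ge2 mp mq (edge_neq epq); lia.
Qed.

End EdgeIdeal.

(** * The linear strand of an edge ideal *)
Section LinearStrand.

Variables (k : fieldType) (n : nat) (e : rel 'I_n).
Hypotheses (e_sym : ssrbool.symmetric e) (e_irr : irreflexive e).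
Local Notation R := {mpoly k[n]}.
Local Notation I := (@edge_ideal k n e).
Local Notation coef2 z A p q := ((z A 0 0)@_(U_(p) + U_(q))).

Definition compl_in (S : {set 'I_n}) : rel 'I_n :=
  fun x y => [&& x \in S, y \in S & ~~ e x y].

Lemma compl_in_connect_sym S : connect_sym (compl_in S).
Proof.
by apply: sym_connect_sym => x y; rewrite /compl_in e_sym andbCA.
Qed.

Lemma compl_in_closed S : closed (compl_in S) S.
Proof. by move=> x y /and3P[-> ->]. Qed.

Lemma root_compl_in S x : (fingraph.root (compl_in S) x \in S) = (x \in S).
Proof. by rewrite -(closed_connect (@compl_in_closed S) (connect_root _ x)). Qed.

(** A vertex of S, the same for all x in S; x is just a default value. *)
Definition base (S : {set 'I_n}) (x : 'I_n) := odflt x [pick y in S].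

Lemma base_in (S : {set 'I_n}) x : x \in S -> base S x \in S.
Proof. by rewrite /base; case: pickP. Qed.

Lemma base_eq (S : {set 'I_n}) x y : x \in S -> base S x = base S y.
Proof. by move=> xS; rewrite /base; case: pickP => // /(_ x); rewrite xS. Qed.

Section Cocycles.

Variable z : chain k n 1.
Hypotheses (zI : forall A, I (z A 0 0)) (dz : koszul z = 0).

Let dz0 A m : (koszul z A 0 0)@_m = 0.
Proof. by rewrite dz ffunE mxE mcoeff0. Qed.

Lemma cochain_nonedge S p q : ~~ e p q -> cochain z S p q = 0.
Proof. by move=> npq; rewrite /cochain (coef2_nonedge e_sym e_irr) ?mulr0. Qed.

Lemma cochain_diag S p : cochain z S p p = 0.
Proof. by rewrite cochain_nonedge // e_irr. Qed.

Lemma cochain_cocycle (S : {set 'I_n}) p q r : p \in S -> q \in S -> r \in S ->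
  cochain z S p r = cochain z S p q + cochain z S q r.
Proof.
move=> pS qS rS.
have [<-|pq] := eqVneq p q; first by rewrite cochain_diag add0r.
have [<-|qr] := eqVneq q r; first by rewrite cochain_diag addr0.
have [->|rp] := eqVneq r p.
  by rewrite cochain_diag (cochain_antisym z S pq) addNr.
have [c c0] := koszul_cochain z pS qS rS pq qr rp.
rewrite dz0 => /esym/eqP; rewrite mulf_eq0 (negPf c0) /= addr_eq0 => /eqP ->.
by rewrite (cochain_antisym z S rp) opprK.
Qed.

(** The function f(x) = cochain b x is a potential of the cocycle, and its values
at two non-adjacent vertices differ by the cochain on a non-edge, which is 0. *)
Lemma cochain_connect (S : {set 'I_n}) b x y : b \in S ->
  connect (compl_in S) x y -> cochain z S b x = cochain z S b y.
Proof.
move=> bS /connectP[p]; elim: p x => [|w p IHp] x /=; first by move=> _ ->.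
case/andP=> /and3P[xS wS nxw] wp yE; rewrite -(IHp w wp yE).
by rewrite (cochain_cocycle bS xS wS) (cochain_nonedge _ nxw) addr0.
Qed.

(** Look at the multidegree of x_p^2 x_q e_(A - p): among the quadratic monomials
available there, x_p^2 is not in I, so only the coefficient of x_p x_q can
contribute to the boundary. *)
Lemma coef2_nonsqfree (A : {set 'I_n}) p q : p \in A -> e p q -> coef2 z A p q = 0.
Proof.
move=> pA epq; have pq := edge_neq e_irr epq.
have := dz0 (A :\ p) (U_(p) + U_(p) + U_(q)); rewrite mcoeff_koszul.
have mE x : ((U_(p) + U_(p) + U_(q))%MM x != 0%N) = (x == p) || (x == q).
  by rewrite mnmDE addn_eq0 negb_and mnm2_neq0 mnm1E eqb0 negbK (eq_sym q) orbb.
rewrite (bigD1 p) /=; last by rewrite mE setD11 eqxx.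
rewrite big1 => [|x]; last first.
  rewrite mE => /andP[/andP[_ /orP[/eqP->|/eqP-> _]]]; first by rewrite eqxx.
  by rewrite addmK (coef2_nonedge e_sym e_irr) ?mulr0 // e_irr.
rewrite addr0 setD1K // -addmA addmC addmK => /eqP.
by rewrite mulf_eq0 signr_eq0 => /eqP.
Qed.

End Cocycles.

Variable i : nat.

(** One element for each S and each component of the complement of S but that of
the base point: a locally constant function on S that vanishes at the base
point is given by its values on these components. *)
Definition strand_basis : {set {set 'I_n} * 'I_n} :=
  [set t : {set 'I_n} * 'I_n | [&& #|t.1| == i.+3, t.2 \in t.1, roots (compl_in t.1) t.2
             & fingraph.root (compl_in t.1) (base t.1 t.2) != t.2]].

Definition strand_coord (z : chain k n 1) : 'rV[k]_#|strand_basis| :=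
  \row_t cochain z (enum_val t).1 (base (enum_val t).1 (enum_val t).2) (enum_val t).2.

Lemma strand_coord_lin c z z' :
  strand_coord (c%:MP *: z + z') = c *: strand_coord z + strand_coord z'.
Proof.
apply/rowP=> t; rewrite !mxE; case: (enum_val t) => S r.
by rewrite /cochain !ffunE !mxE mcoeffD mcoeffCM mulrDr mulrCA.
Qed.

Lemma strand_coord_inj z : ideal_chain I i.+1 i.+3 z -> koszul z = 0 ->
  strand_coord z = 0 -> z = 0.
Proof.
move=> [hz zI] dz z0.
have cochain0 (S : {set 'I_n}) p q : #|S| = i.+3 -> p \in S -> q \in S -> cochain z S p q = 0.
  move=> cS pS qS; pose b := base S p; have bS : b \in S by apply: base_in.
  suff cb0 x : x \in S -> cochain z S b x = 0.
    have := cochain_cocycle zI dz bS pS qS; rewrite !cb0 // add0r => <- //.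
  move=> xS; rewrite (cochain_connect zI dz bS (connect_root _ x)).
  set r := fingraph.root _ x; have rS : r \in S by rewrite root_compl_in.
  have rr : roots (compl_in S) r by apply: roots_root; apply: compl_in_connect_sym.
  have bE y : y \in S -> base S y = b by move=> yS; apply: base_eq.
  have [rbE|rb] := eqVneq (fingraph.root (compl_in S) b) r.
    by rewrite -rbE -(cochain_connect zI dz bS (connect_root _ b)) cochain_diag.
  have tT : (S, r) \in strand_basis by rewrite inE /= cS eqxx rS rr bE.
  have := congr1 (fun v : 'rV_#|strand_basis| => v 0 (enum_rank_in tT (S, r))) z0.
  by rewrite !mxE enum_rankK_in //= bE.
apply/ffunP=> A; apply/rowP=> b; rewrite ord1 ffunE mxE.
apply/mpolyP=> m; rewrite mcoeff0; apply/eqP/negPn/negP=> nz.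
have [cA] := hz _ _ _ nz; rewrite addn0 => mj.
have m2 : mdeg m = 2 by lia.
have [p [q [epq mp mq]]] := edge_ideal_msupp (zI A) nz.
have pq := edge_neq e_irr epq; have mE := mdeg2_eq m2 mp mq pq.
move/eqP: nz; apply; rewrite mE.
have [pA|pA] := boolP (p \in A); first exact: coef2_nonsqfree.
have [qA|qA] := boolP (q \in A).
  by rewrite addmC; apply: coef2_nonsqfree => //; rewrite e_sym.
have := cochain0 (p |: (q |: A)) p q; rewrite !cardsU1 !inE (negPf pq) pA qA cA !eqxx orbT.
move=> /(_ erefl isT isT); rewrite /cochain.
have -> : (p |: (q |: A)) :\ p :\ q = A by rewrite setU1K ?setU1K // !inE negb_or pq.
by move/eqP; rewrite !mulf_eq0 !signr_eq0 => /eqP.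
Qed.

(** Conversely, prescribed values on the components define a locally constant
function on each S, whose coboundary is the cochain of a Koszul cycle. *)
Section StrandChain.

Variable g : 'rV[k]_#|strand_basis|.

Definition potential (S : {set 'I_n}) (x : 'I_n) : k :=
  \sum_(t < #|strand_basis| | enum_val t == (S, fingraph.root (compl_in S) x)) g 0 t.

Definition strand_coef (A : {set 'I_n}) (m : 'X_{1..n}) : k :=
  if #|A| == i.+1 then
    if [pick pq : 'I_n * 'I_n | [&& (pq.1 < pq.2)%N, pq.1 \notin A, pq.2 \notin A
          & m == (U_(pq.1) + U_(pq.2))%MM]] is Some (p, q) then
      let S := p |: (q |: A) in
      sgn k p S * sgn k q S * (potential S p - potential S q)
    else 0
  else 0.

Definition strand_chain : chain k n 1 :=
  [ffun A : {set 'I_n} => \row__ mpoly_of 3 (strand_coef A)].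

Lemma strand_coef_neq0 A m : strand_coef A m != 0 -> exists p q : 'I_n,
  [/\ [/\ #|A| = i.+1, (p < q)%N, p \notin A & q \notin A], m = (U_(p) + U_(q))%MM &
    potential (p |: (q |: A)) p != potential (p |: (q |: A)) q].
Proof.
rewrite /strand_coef; case: (#|A| =P i.+1) => [cA|_]; last by rewrite eqxx.
case: pickP => [[p q] /= /and4P[pq pA qA /eqP mE]|_]; last by rewrite eqxx.
by rewrite !mulf_eq0 !signr_eq0 subr_eq0 /= => pot; exists p, q.
Qed.

Lemma strand_coefE (A : {set 'I_n}) (p q : 'I_n) :
  #|A| = i.+1 -> (p < q)%N -> p \notin A -> q \notin A ->
  let S := p |: (q |: A) in strand_coef A (U_(p) + U_(q)) =
    sgn k p S * sgn k q S * (potential S p - potential S q).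
Proof.
move=> cA pq pA qA S; rewrite /strand_coef cA eqxx.
case: pickP => [[p' q'] /= /and4P[pq' _ _ /eqP/mnmP mE]|/(_ (p, q))]; last first.
  by rewrite /= pq pA qA eqxx.
have memE x : (x == p) || (x == q) = (x == p') || (x == q').
  by rewrite -!mnm2_neq0 mE.
have := memE p'; have := memE q'; rewrite !eqxx orbT => /orP[] /eqP qE /orP[] /eqP pE;
  move: pq'; rewrite pE qE ?ltnn // ltnNge ltnW //.
Qed.

Lemma mcoeff_strand_chain A m : (strand_chain A 0 0)@_m = strand_coef A m.
Proof.
rewrite ffunE mxE mcoeff_mpoly_of // => m' /strand_coef_neq0[p [q [_ -> _]]].
by rewrite mdegD !mdeg1.
Qed.

Lemma strand_chain_graded : graded (fun=> 0%N) i.+1 i.+3 strand_chain.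
Proof.
move=> A b m; rewrite ord1 mcoeff_strand_chain => /strand_coef_neq0[p [q [[-> _ _ _] -> _]]].
by split=> //; rewrite mdegD !mdeg1 addn0.
Qed.

Lemma strand_chain_ideal A : I (strand_chain A 0 0).
Proof.
apply: edge_ideal_mdeg2 => m; rewrite mcoeff_strand_chain.
case/strand_coef_neq0=> p [q [_ -> pot]]; exists p, q; split=> //.
apply: contraNT pot => npq; rewrite /potential.
have /(fingraph.rootP (compl_in_connect_sym _)) -> // : connect (compl_in (p |: (q |: A))) p q.
by apply: connect1; rewrite /compl_in !inE !eqxx orbT.
Qed.

Lemma cochain_strand_chain (S : {set 'I_n}) p q : #|S| = i.+3 -> p \in S -> q \in S ->
  p != q -> cochain strand_chain S p q = potential S q - potential S p.
Proof.
move=> cS; wlog pq : p q / (p < q)%N => [hwlog|] pS qS npq.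
  have [pq|qp|/val_inj pq] := ltngtP p q; first exact: hwlog.
    by rewrite cochain_antisym // hwlog ?opprB // eq_sym.
  by rewrite pq eqxx in npq.
have SE : p |: (q |: (S :\ p :\ q)) = S.
  by rewrite setD1K ?setD1K // !inE eq_sym npq.
have cA : #|S :\ p :\ q| = i.+1.
  by move: cS; rewrite -{1}SE !cardsU1 !inE (negPf npq) !eqxx andbF !add1n => -[].
rewrite /cochain mcoeff_strand_chain strand_coefE ?inE ?eqxx ?andbF // SE pq.
case: (sgn_pm1 k p S) => ->; case: (sgn_pm1 k q S) => ->; rewrite expr1; ring.
Qed.

(** A coefficient of the boundary that is not a sum of zeros lives at a monomial
x_x x_p x_q with distinct indices outside A; there it is the coboundary of a
coboundary. *)
Lemma koszul_strand_chain : koszul strand_chain = 0.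
Proof.
have hd := graded_koszul strand_chain_graded.
apply/ffunP=> A; apply/rowP=> b; rewrite ord1 [RHS](_ : _ = 0); last by rewrite ffunE mxE.
apply/mpolyP=> m; rewrite mcoeff0; apply/eqP/negPn/negP=> nz.
have [cA _] := hd _ _ _ nz.
have [x /andP[xA mx]] : exists2 x, (x \notin A) && (m x != 0%N) &
    (strand_chain (x |: A) 0 0)@_(m - U_(x)) != 0.
  apply/exists_inP; apply: contraNT nz; rewrite mcoeff_koszul => /exists_inPn z.
  by apply/eqP/big1 => x Px; move/negPn/eqP: (z x Px) => ->; rewrite mulr0.
rewrite mcoeff_strand_chain => /strand_coef_neq0[p [q [[_ pq pA qA] mE _]]].
have {mE} mE : m = (U_(x) + U_(p) + U_(q))%MM by rewrite -(subUK mx) mE addmC addmA.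
move: pA qA; rewrite !inE !negb_or => /andP[px pA] /andP[qx qA].
have {}pq : p != q by rewrite neq_ltn pq.
pose S := x |: (p |: (q |: A)).
have xS : x \in S by rewrite !inE eqxx.
have pS : p \in S by rewrite !inE eqxx orbT.
have qS : q \in S by rewrite !inE eqxx !orbT.
have SE : S :\ x :\ p :\ q = A.
  by rewrite !setU1K // !inE ?negb_or ?pq ?[x == _]eq_sym ?px ?qx.
have cS : #|S| = i.+3.
  by rewrite !cardsU1 !inE !negb_or pA qA xA pq ![x == _]eq_sym px qx cA.
have xp : x != p by rewrite eq_sym.
have [c _] := koszul_cochain strand_chain xS pS qS xp pq qx.
rewrite SE -mE !cochain_strand_chain // => dE; case/eqP: nz; rewrite dE.
ring.
Qed.

Lemma strand_coord_chain : strand_coord strand_chain = g.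
Proof.
apply/rowP=> t; rewrite mxE; case tE: (enum_val t) => [S r].
have := enum_valP t; rewrite tE inE /= => /and4P[/eqP cS rS /eqP rr rb].
have bS := base_in rS.
have br : base S r != r by apply: contraNneq rb => ->; rewrite rr.
rewrite cochain_strand_chain // {1}/potential rr (big_pred1 t); last first.
  by move=> t' /=; rewrite -tE (inj_eq enum_val_inj).
rewrite /potential big1 ?subr0 // => t' /eqP t'E.
have := enum_valP t'; rewrite t'E inE /= root_compl_in bS => /and4P[_ _ _].
rewrite (@base_eq S _ r) ?root_compl_in //.
by rewrite eqxx.
Qed.

End StrandChain.

(** There are no forms of degree 1 in I, hence no boundaries to divide out: the
homology is the space of cycles, with the coordinates [strand_coord]. *)
Theorem betti_linear_strand (F : graded_free_resolution I) :
  betti F i.+1 i.+3 = #|strand_basis|.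
Proof.
apply: (betti_koszul F strand_coord_lin) => [z hz dz|g].
  split=> [z0|[y /(ideal_chain_mdeg_gt2 e_irr) -> ->]].
    exists 0; last by rewrite koszul0; apply: strand_coord_inj.
    split=> [|A]; first exact: graded0.
    apply: edge_ideal_mdeg2 => m; rewrite ffunE mxE mcoeff0 eqxx //.
  have := strand_coord_lin (-1) 0 0.
  by rewrite koszul0 scaler0 addr0 scaleN1r addNr.
exists (strand_chain g); split.
- by split; [apply: strand_chain_graded | apply: strand_chain_ideal].
- exact: koszul_strand_chain.
- exact: strand_coord_chain.
Qed.

Lemma card_strand_basis :
  #|strand_basis| = (\sum_(S : {set 'I_n} | #|S| == i.+3) (n_comp (compl_in S) S).-1)%N.
Proof.
pose Q (S : {set 'I_n}) r := [&& r \in S, roots (compl_in S) r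
  & fingraph.root (compl_in S) (base S r) != r].
transitivity (\sum_(S : {set 'I_n} | #|S| == i.+3) \sum_(r | Q S r) 1)%N.
  by rewrite pair_big_dep /= -sum1_card; apply: eq_bigl => t; rewrite inE.
apply: eq_bigr => S /eqP cS; rewrite sum1_card.
have [x xS] : exists x, x \in S by apply/set0Pn; rewrite -card_gt0 cS.
pose b := fingraph.root (compl_in S) (base S x).
have bP : b \in predI (roots (compl_in S)) (mem S).
  rewrite inE /= roots_root /=; last exact: compl_in_connect_sym.
  by rewrite root_compl_in base_in.
rewrite [n_comp _ _](cardD1 b) bP; apply: eq_card => r.
rewrite unfold_in /Q !inE /= /b (base_eq r xS) eq_sym.
by case: (r \in S); rewrite ?andbF ?andbT //= andbC.
Qed.

End LinearStrand.

(** * From vertex subsets to graphs on ordinals *)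
Section Restriction.

Variables (n : nat) (e : rel 'I_n).
Hypotheses (e_sym : ssrbool.symmetric e) (e_irr : irreflexive e).

Definition dominating (V : finType) (g : rel V) : {set V} :=
  [set x | [forall y, (y != x) ==> g x y]].

Variables (m : nat) (h : 'I_m -> 'I_n).
Hypothesis h_inj : injective h.
Let S := [set h x | x : 'I_m].
Let g : rel 'I_m := fun x y => e (h x) (h y).

Lemma n_comp_restrict : n_comp (compl_in e S) S = n_comp (fun x y => ~~ g x y) 'I_m.
Proof.
have h_adj : rel_adjunction h (compl_in e S) (fun x y => ~~ g x y) S.
  apply: strict_adjunction => //.
  - exact: sym_connect_sym (fun x y => congr1 negb (e_sym _ _)).
  - exact: compl_in_closed.
  - by apply/subsetP=> _ /imsetP[x _ ->]; apply: codom_f.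
  - by move=> x y _; rewrite /compl_in !imset_f.
rewrite (adjunction_n_comp h _ _ _ h_adj).
- by apply: eq_n_comp_r => x; rewrite !inE imset_f.
- exact: compl_in_connect_sym.
- exact: sym_connect_sym (fun x y => congr1 negb (e_sym _ _)).
- exact: compl_in_closed.
Qed.

Lemma induced_iso_restrict (U : finType) (r : rel U) :
  induced_iso e r S = induced_iso g r [set: 'I_m].
Proof.
apply/existsP/existsP => -[f /and3P[/injectiveP f_inj /eqP fS /'forall_forallP fr]].
  have f_im u : exists x, f u = h x.
    have : f u \in S by rewrite -fS imset_f.
    by case/imsetP=> x _ ->; exists x.
  have /fin_all_exists[f' f'P] u := f_im u.
  exists [ffun u => f' u]; apply/and3P; split.
  - by apply/injectiveP=> u v; rewrite !ffunE => E; apply: f_inj; rewrite !f'P E.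
  - apply/eqP/setP=> x; rewrite inE; apply/imsetP.
    have : h x \in S by apply: imset_f.
    rewrite -fS => /imsetP[u _ E]; exists u => //; rewrite ffunE.
    by apply: h_inj; rewrite E f'P.
  - by apply/'forall_forallP=> u v; rewrite !ffunE /g -!f'P.
exists [ffun u => h (f u)]; apply/and3P; split.
- by apply/injectiveP=> u v; rewrite !ffunE => /h_inj/f_inj.
- apply/eqP/setP=> y; apply/imsetP/imsetP=> [[u _ ->]|[x _ ->]].
    by exists (f u); rewrite ?ffunE.
  have : x \in [set: 'I_m] by [].
  by rewrite -fS => /imsetP[u _ ->]; exists u; rewrite ?ffunE.
- by apply/'forall_forallP=> u v; rewrite !ffunE fr.
Qed.

Lemma dominating_restrict :
  #|[set v in S | S :\ v \subset [set w | e v w]]| = #|dominating g|.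
Proof.
rewrite -(card_imset _ h_inj); apply: eq_card => v; rewrite inE.
apply/andP/imsetP=> [[/imsetP[x _ ->] sub]|[x]]; last first.
  rewrite inE => /forallP gx ->; split; first exact: imset_f.
  apply/subsetP=> w; rewrite !inE => /andP[wx /imsetP[y _ wE]].
  by move: wx; rewrite wE (inj_eq h_inj) => yx; apply: (implyP (gx y)).
exists x => //; rewrite inE; apply/forallP=> y; apply/implyP=> yx.
have : h y \in S :\ h x by rewrite !inE (inj_eq h_inj) yx imset_f.
by move/(subsetP sub); rewrite inE.
Qed.

End Restriction.

Section SumOverSubsets.

Variables (n : nat) (e : rel 'I_n).
Hypotheses (e_sym : ssrbool.symmetric e) (e_irr : irreflexive e).

(** Both sides count the pairs of a vertex v and a set A of m neighbours of v; such a
pair is recorded by v and the set S = v |: A. *)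
Lemma sum_bin_degree m :
  (\sum_v 'C(degree e v, m) =
   \sum_(S : {set 'I_n} | #|S| == m.+1) #|[set v in S | S :\ v \subset [set w | e v w]]|)%N.
Proof.
transitivity (\sum_(v : 'I_n) \sum_(S : {set 'I_n} |
    (#|S| == m.+1) && ((v \in S) && (S :\ v \subset [set w | e v w]))) 1)%N.
  apply: eq_bigr => v _; rewrite /degree -cards_draws sum1_card.
  have vN (A : {set 'I_n}) : A \subset [set w | e v w] -> v \notin A.
    by move=> sA; apply/negP=> /(subsetP sA); rewrite inE e_irr.
  rewrite -(@card_in_imset _ _ (fun A => v |: A)) => [|A B]; last first.
    rewrite !inE => /andP[sA _] /andP[sB _] E.
    by rewrite -(setU1K (vN _ sA)) E setU1K ?vN.
  apply: eq_card => S; rewrite unfold_in.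
  apply/imsetP/and3P=> [[A]|[cS vS sS]].
    rewrite inE => /andP[sA /eqP cA] ->.
    by rewrite cardsU1 vN // cA !inE eqxx setU1K ?vN.
  exists (S :\ v); last by rewrite setD1K.
  by move: cS; rewrite inE sS (cardsD1 v S) vS add1n eqSS.
rewrite (exchange_big_dep (fun S : {set 'I_n} => #|S| == m.+1)) /=; last by move=> v S _ /andP[].
apply: eq_bigr => S cS; rewrite sum1_card; apply: eq_card => v.
by rewrite !inE unfold_in /= cS.
Qed.

Lemma sum_induced (U : finType) (r : rel U) :
  num_induced e r = (\sum_(S : {set 'I_n} | #|S| == #|U|) induced_iso e r S)%N.
Proof.
rewrite /num_induced -sum1_card big_mkcond [RHS]big_mkcond.
apply: eq_bigr => S _; rewrite inE.
case: ifP => [|_]; last by rewrite if_same.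
move=> iso; case/existsP: (iso) => f /and3P[/injectiveP f_inj /eqP <- _].
by rewrite card_imset // cardsT eqxx.
Qed.

Lemma restrict_graph m (S : {set 'I_n}) : #|S| = m -> exists g : rel 'I_m,
  [/\ ssrbool.symmetric g /\ irreflexive g,
      n_comp (compl_in e S) S = n_comp (fun x y => ~~ g x y) 'I_m,
      #|[set v in S | S :\ v \subset [set w | e v w]]| = #|dominating g| &
      forall (U : finType) (r : rel U),
        induced_iso e r S = induced_iso g r [set: 'I_m]].
Proof.
move=> cS; pose h (x : 'I_m) : 'I_n := enum_val (cast_ord (esym cS) x).
have h_inj : injective h by move=> x y /enum_val_inj/cast_ord_inj.
have SE : S = [set h x | x : 'I_m].
  apply/eqP; rewrite eq_sym eqEcard card_imset // card_ord cS leqnn andbT.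
  by apply/subsetP=> _ /imsetP[x _ ->]; apply: enum_valP.
exists (fun x y => e (h x) (h y)); rewrite SE; split.
- by split=> [x y|x]; rewrite ?e_irr.
- exact: n_comp_restrict.
- exact: dominating_restrict.
- by move=> U r; apply: induced_iso_restrict.
Qed.

End SumOverSubsets.

(** * Deciding graph invariants by computation *)
Section ComputableGraphs.

(** The enumeration of a finite type is locked, so this explicit list is what makes
the evaluations below possible. *)
Fixpoint ords m : seq 'I_m :=
  if m is m'.+1 then ord0 :: [seq lift ord0 x | x <- ords m'] else [::].

Lemma ordsE m : ords m = enum 'I_m.
Proof.
elim: m => [|m IHm]; first by apply/esym/size0nil; rewrite size_enum_ord.
by rewrite enum_ordSl -IHm.
Qed.

Lemma mem_ords m (x : 'I_m) : x \in ords m.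
Proof. by rewrite ordsE mem_enum. Qed.

Lemma ords_uniq m : uniq (ords m).
Proof. by rewrite ordsE enum_uniq. Qed.

Lemma size_ords m : size (ords m) = m.
Proof. by rewrite ordsE size_enum_ord. Qed.

Variable m : nat.
Implicit Types g : rel 'I_m.

Definition ord_pairs : seq ('I_m * 'I_m) :=
  [seq p : 'I_m * 'I_m <- [seq (x, y) | x <- ords m, y <- ords m] | (p.1 < p.2)%N].

Lemma mem_ord_pairs (x y : 'I_m) : ((x, y) \in ord_pairs) = (x < y)%N.
Proof.
by rewrite mem_filter (allpairs_f (fun x y => (x, y))) ?mem_ords ?andbT.
Qed.

(** A graph is coded by its adjacencies x < y, listed in the order of [ord_pairs]. *)
Definition code g : bitseq := [seq g p.1 p.2 | p <- ord_pairs].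

Definition graph_of (b : bitseq) : rel 'I_m := fun x y =>
  if (x < y)%N then nth false b (index (x, y) ord_pairs)
  else if (y < x)%N then nth false b (index (y, x) ord_pairs) else false.

Lemma graph_of_code g : ssrbool.symmetric g -> irreflexive g -> graph_of (code g) =2 g.
Proof.
move=> g_sym g_irr x y; rewrite /graph_of /code.
have nthE (a c : 'I_m) : (a < c)%N -> nth false [seq g p.1 p.2 | p <- ord_pairs]
    (index (a, c) ord_pairs) = g a c.
  by rewrite -mem_ord_pairs => ac; rewrite (nth_map (a, c)) ?index_mem // nth_index.
case: ltngtP => [/nthE //|/nthE ->|/val_inj ->]; first exact: g_sym.
by rewrite g_irr.
Qed.

Lemma eq_code g g' : g =2 g' -> code g = code g'.
Proof. by move=> E; apply: eq_map => p; rewrite E. Qed.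

Fixpoint all_bitseq (l : nat) (P : pred bitseq) : bool :=
  if l is l'.+1 then
    all_bitseq l' (fun b => P (true :: b)) && all_bitseq l' (fun b => P (false :: b))
  else P [::].

Lemma all_bitseqP l (P : pred bitseq) b : all_bitseq l P -> size b = l -> P b.
Proof.
elim: l P b => [|l IHl] P [|c b] //= /andP[Pt Pf] [sb].
by case: c; [apply: (IHl _ _ Pt) | apply: (IHl _ _ Pf)].
Qed.

Definition non_neighbours g : seq (seq 'I_m) :=
  [seq [seq y <- ords m | ~~ g x y] | x <- ords m].

(** The depth-first search that defines [connect], run on tabulated neighbour lists. *)
Definition reach (adj : seq (seq 'I_m)) (x : 'I_m) : seq 'I_m :=
  dfs (fun y : 'I_m => nth [::] adj y) m [::] x.

Lemma mem_reach g x y :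
  (y \in reach (non_neighbours g) x) = connect (fun x y => ~~ g x y) x y.
Proof.
have gE : grel (fun y : 'I_m => nth [::] (non_neighbours g) y) =2 (fun x y => ~~ g x y).
  move=> a b; rewrite /= (nth_map a) ?size_ords // mem_filter mem_ords andbT.
  by rewrite ordsE nth_ord_enum.
have := @dfsP _ (fun y : 'I_m => nth [::] (non_neighbours g) y) x y.
rewrite card_ord -/(reach _ x) => reachP.
by apply/reachP/connectP => -[p]; exists p; rewrite ?(eq_path gE) // -?(eq_path gE).
Qed.

(** A component of the complement is counted through its least vertex. *)
Definition count_comp g : nat :=
  let adj := non_neighbours g in
  count (fun x : 'I_m => all (fun y : 'I_m => (x <= y)%N) (reach adj x)) (ords m).

Lemma card_count (P : pred 'I_m) : #|[set x | P x]| = count P (ords m).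
Proof. by rewrite cardsE cardE ordsE size_filter -enumT. Qed.

Lemma count_compE g : ssrbool.symmetric g ->
  n_comp (fun x y => ~~ g x y) 'I_m = count_comp g.
Proof.
move=> g_sym; set r := fun x y => _.
have r_sym : connect_sym r by apply: sym_connect_sym => x y; rewrite /r g_sym.
rewrite /count_comp -card_count.
have minE (x : 'I_m) : all (fun y : 'I_m => (x <= y)%N) (reach (non_neighbours g) x) =
    [forall y, connect r x y ==> (x <= y)%N].
  apply/allP/forallP => [xm y|xm y]; last by rewrite mem_reach; apply/implyP.
  by apply/implyP; rewrite -mem_reach; apply: xm.
rewrite -(@card_in_imset _ _ (fingraph.root r)) => [|x y].
  apply: eq_card => z; rewrite !inE andbT; apply/idP/imsetP => [rz|[x _ ->]].
    have [x xz xmin] := @arg_minnP _ z (connect r z) val (connect0 _ _).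
    exists x; last by rewrite -(eqP rz); apply/fingraph.rootP.
    rewrite inE minE; apply/forallP=> y; apply/implyP=> xy.
    by apply: xmin; apply: connect_trans xz xy.
  exact: roots_root.
rewrite !inE !minE => /forallP xm /forallP ym /(fingraph.rootP r_sym) xy.
apply/val_inj/eqP; rewrite eqn_leq (implyP (xm y)) // (implyP (ym x)) //.
by rewrite r_sym.
Qed.

Definition count_dom g : nat :=
  count (fun x => all (fun y => (y != x) ==> g x y) (ords m)) (ords m).

Lemma count_domE g : #|dominating g| = count_dom g.
Proof.
rewrite /count_dom -card_count; apply: eq_card => x; rewrite !inE.
apply/forallP/allP => gx y; first by move=> _; apply: gx.
by apply: gx; apply: mem_ords.
Qed.

(** The codes of all the relabellings of r by the vertex set of g: an isomorphism is
an enumeration q of the vertices of r. *)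
Definition orbit_codes (U : eqType) (u0 : U) (su : seq U) (r : rel U) : seq bitseq :=
  [seq code (fun x y => r (nth u0 q x) (nth u0 q y)) | q <- permutations su].

Lemma induced_iso_orbit (U : finType) (u0 : U) (su : seq U) (r : rel U) g :
  ssrbool.symmetric r -> irreflexive r -> uniq su -> (forall u, u \in su) -> size su = m ->
  ssrbool.symmetric g -> irreflexive g ->
  induced_iso g r [set: 'I_m] = (code g \in orbit_codes u0 su r).
Proof.
move=> r_sym r_irr su_uniq su_full su_size g_sym g_irr.
have cU : #|U| = m.
  by rewrite -su_size -(card_uniqP su_uniq); apply: eq_card => u; rewrite su_full.
apply/existsP/mapP => [[f /and3P[/injectiveP f_inj _ /'forall_forallP fr]]|[q]].
  have [f' fK f'K] : bijective f by apply: inj_card_bij; rewrite // cU card_ord.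
  exists [seq f' x | x <- ords m].
    rewrite mem_permutations; apply: uniq_perm => // [|u].
      by rewrite map_inj_uniq ?ords_uniq //; apply: can_inj f'K.
    by rewrite su_full -(fK u) map_f ?mem_ords.
  apply: eq_code => x y.
  have nthE (z : 'I_m) : nth u0 [seq f' x | x <- ords m] z = f' z.
    rewrite (nth_map z) ?size_ords // ordsE nth_ord_enum //.
  by rewrite !nthE -(eqP (fr _ _)) !f'K.
rewrite mem_permutations => q_su gE.
have q_uniq : uniq q by rewrite (perm_uniq q_su).
have q_size : size q = m by rewrite (perm_size q_su).
pose h (x : 'I_m) := nth u0 q x.
have h_inj : injective h.
  by move=> x y /eqP; rewrite nth_uniq ?q_size // => /eqP/val_inj.
have [h' hK h'K] : bijective h by apply: inj_card_bij; rewrite // cU card_ord.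
have gr x y : g x y = r (h x) (h y).
  rewrite -graph_of_code // gE graph_of_code // => a b; exact: r_sym.
exists [ffun u => h' u]; apply/and3P; split.
- by apply/injectiveP=> u v; rewrite !ffunE => /(can_inj h'K).
- apply/eqP/setP=> x; rewrite inE; apply/imsetP; exists (h x) => //.
  by rewrite ffunE hK.
- by apply/'forall_forallP=> u v; rewrite !ffunE gr !h'K.
Qed.

Lemma n_comp_code g : ssrbool.symmetric g -> irreflexive g ->
  n_comp (fun x y => ~~ g x y) 'I_m = count_comp (graph_of (code g)).
Proof.
move=> g_sym g_irr; have gE := graph_of_code g_sym g_irr.
rewrite -count_compE => [|x y]; last by rewrite !gE g_sym.
by apply: eq_n_comp; apply: eq_connect => x y; rewrite gE.
Qed.

Lemma card_dominating_code g : ssrbool.symmetric g -> irreflexive g ->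
  #|dominating g| = count_dom (graph_of (code g)).
Proof.
move=> g_sym g_irr; rewrite -count_domE; apply: eq_card => x; rewrite !inE.
by apply: eq_forallb => y; rewrite graph_of_code.
Qed.

End ComputableGraphs.

(** * Graphs on four and five vertices *)
Section SmallGraphs.

Definition vertices_biclique a b : seq ('I_a + 'I_b) :=
  [seq inl x | x <- ords a] ++ [seq inr x | x <- ords b].

Lemma vertices_biclique_uniq a b : uniq (vertices_biclique a b).
Proof.
rewrite cat_uniq !map_inj_uniq ?ords_uniq; [|by move=> ? ? []..].
by rewrite andbT -all_predC; apply/allP=> _ /mapP[x _ ->]; apply/mapP => -[].
Qed.

Lemma mem_vertices_biclique a b u : u \in vertices_biclique a b.
Proof. by case: u => x; rewrite mem_cat map_f ?mem_ords ?orbT. Qed.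

Definition vertices_wheel m : seq (option 'I_m) := None :: [seq Some x | x <- ords m].

Lemma mem_vertices_wheel m u : u \in vertices_wheel m.
Proof. by case: u => // x; rewrite in_cons map_f ?mem_ords. Qed.

Lemma complete_graph_sym m : ssrbool.symmetric (@complete_graph m).
Proof. by move=> x y; rewrite /complete_graph eq_sym. Qed.

Lemma complete_graph_irr m : irreflexive (@complete_graph m).
Proof. by move=> x; rewrite /complete_graph eqxx. Qed.

Lemma complete_bipartite_sym a b : ssrbool.symmetric (@complete_bipartite a b).
Proof. by move=> [] x [] y. Qed.

Lemma complete_bipartite_irr a b : irreflexive (@complete_bipartite a b).
Proof. by case. Qed.

Lemma wheel_graph_sym m : ssrbool.symmetric (@wheel_graph m).
Proof. by move=> [x|] [y|] //=; rewrite /cycle_graph orbC. Qed.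

Lemma wheel4_irr : irreflexive (@wheel_graph 4).
Proof. by move=> [[[|[|[|[|]]]] ?]|]. Qed.

Lemma graph_D_sym : ssrbool.symmetric graph_D.
Proof. by move=> x y; rewrite /graph_D orbC. Qed.

Lemma graph_D_irr : irreflexive graph_D.
Proof. by move=> [[|[|[|[|[|]]]]] ?]. Qed.

Let K4 := orbit_codes 4 ord0 (ords 4) (@complete_graph 4).
Let K22 := orbit_codes 4 (inl ord0) (vertices_biclique 2 2) (@complete_bipartite 2 2).

(** The left-hand side exceeds the number of dominating vertices exactly when the
complement has two components that are not single vertices. *)
Lemma graph_identity4 : all_bitseq 6 (fun b => let g := @graph_of 4 b in
  (count_comp g).-1 + (b \in K4) == count_dom g + (b \in K22))%N.
Proof. vm_cast_no_check (erefl true). Qed.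

Let K5 := orbit_codes 5 ord0 (ords 5) (@complete_graph 5).
Let K23 := orbit_codes 5 (inl ord0) (vertices_biclique 2 3) (@complete_bipartite 2 3).
Let W4 := orbit_codes 5 None (vertices_wheel 4) (@wheel_graph 4).
Let D := orbit_codes 5 ord0 (ords 5) graph_D.

(** The two large components of an exceptional complement have sizes 2 and 2, or 2
and 3; in the latter case the larger one is a triangle or a path. *)
Lemma graph_identity5 : all_bitseq 10 (fun b => let g := @graph_of 5 b in
  (count_comp g).-1 + (b \in K5) ==
  count_dom g + (b \in K23) + (b \in W4) + (b \in D))%N.
Proof. vm_cast_no_check (erefl true). Qed.

Lemma induced_iso_complete m (g : rel 'I_m.+1) : ssrbool.symmetric g -> irreflexive g ->
  induced_iso g (@complete_graph m.+1) [set: 'I_m.+1] =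
  (code g \in orbit_codes m.+1 ord0 (ords m.+1) (@complete_graph m.+1)).
Proof.
apply: induced_iso_orbit; rewrite ?ords_uniq ?size_ords //.
- exact: complete_graph_sym.
- exact: complete_graph_irr.
- exact: mem_ords.
Qed.

Lemma induced_iso_biclique a b m (g : rel 'I_m) : (a.+1 + b)%N = m ->
  ssrbool.symmetric g -> irreflexive g ->
  induced_iso g (@complete_bipartite a.+1 b) [set: 'I_m] =
  (code g \in orbit_codes m (inl ord0) (vertices_biclique a.+1 b)
     (@complete_bipartite a.+1 b)).
Proof.
move=> mE; apply: induced_iso_orbit.
- exact: complete_bipartite_sym.
- exact: complete_bipartite_irr.
- exact: vertices_biclique_uniq.
- exact: mem_vertices_biclique.
- by rewrite size_cat !size_map !size_ords.
Qed.

Lemma induced_iso_wheel4 (g : rel 'I_5) : ssrbool.symmetric g -> irreflexive g ->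
  induced_iso g (@wheel_graph 4) [set: 'I_5] =
  (code g \in orbit_codes 5 None (vertices_wheel 4) (@wheel_graph 4)).
Proof.
apply: induced_iso_orbit => //.
- exact: wheel_graph_sym.
- exact: wheel4_irr.
- exact: mem_vertices_wheel.
Qed.

Lemma induced_iso_D (g : rel 'I_5) : ssrbool.symmetric g -> irreflexive g ->
  induced_iso g graph_D [set: 'I_5] = (code g \in orbit_codes 5 ord0 (ords 5) graph_D).
Proof.
apply: induced_iso_orbit => //.
- exact: graph_D_sym.
- exact: graph_D_irr.
- exact: mem_ords.
Qed.

Lemma n_comp_compl4 (g : rel 'I_4) : ssrbool.symmetric g -> irreflexive g ->
  ((n_comp (fun x y => ~~ g x y) 'I_4).-1 +
     induced_iso g (@complete_graph 4) [set: 'I_4] =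
   #|dominating g| + induced_iso g (@complete_bipartite 2 2) [set: 'I_4])%N.
Proof.
move=> g_sym g_irr; have size_g : size (code g) = 6 by rewrite size_map.
rewrite (n_comp_code g_sym g_irr) (card_dominating_code g_sym g_irr).
rewrite (induced_iso_complete g_sym g_irr) (@induced_iso_biclique 1 2 _ _ erefl g_sym g_irr).
exact: eqP (all_bitseqP graph_identity4 size_g).
Qed.

Lemma n_comp_compl5 (g : rel 'I_5) : ssrbool.symmetric g -> irreflexive g ->
  ((n_comp (fun x y => ~~ g x y) 'I_5).-1 +
     induced_iso g (@complete_graph 5) [set: 'I_5] =
   #|dominating g| + induced_iso g (@complete_bipartite 2 3) [set: 'I_5] +
     induced_iso g (@wheel_graph 4) [set: 'I_5] + induced_iso g graph_D [set: 'I_5])%N.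
Proof.
move=> g_sym g_irr; have size_g : size (code g) = 10 by rewrite size_map.
rewrite (n_comp_code g_sym g_irr) (card_dominating_code g_sym g_irr).
rewrite (induced_iso_complete g_sym g_irr) (@induced_iso_biclique 1 3 _ _ erefl g_sym g_irr).
rewrite (induced_iso_wheel4 g_sym g_irr) (induced_iso_D g_sym g_irr).
exact: eqP (all_bitseqP graph_identity5 size_g).
Qed.

End SmallGraphs.

(** * The two Betti numbers *)
Theorem proposition2p8 (k : fieldType) (n : nat) (e : rel 'I_n)
    (e_sym : ssrbool.symmetric e) (e_irr : irreflexive e)
    (F : graded_free_resolution (@edge_ideal k n e)) :
  ((betti F 2 4)%:Z =
     (\sum_(v : 'I_n) 'C(degree e v, 3))%N%:Z
     - (num_induced e (@complete_graph 4))%:Z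
     + (num_induced e (@complete_bipartite 2 2))%:Z)
  /\
  ((betti F 3 5)%:Z =
     (\sum_(v : 'I_n) 'C(degree e v, 4))%N%:Z
     - (num_induced e (@complete_graph 5))%:Z
     + (num_induced e (@complete_bipartite 2 3))%:Z
     + (num_induced e (@wheel_graph 4))%:Z
     + (num_induced e graph_D)%:Z).
Proof.
have sumE m := sum_bin_degree e_irr m.
split.
  rewrite (betti_linear_strand e_sym e_irr _ F) card_strand_basis // sumE.
  rewrite !sum_induced card_sum !card_ord (_ : 2 + 2 = 4)%N //.
  have : (\sum_(S : {set 'I_n} | #|S| == 4) (n_comp (compl_in e S) S).-1 +
      \sum_(S : {set 'I_n} | #|S| == 4) induced_iso e (@complete_graph 4) S =
    \sum_(S : {set 'I_n} | #|S| == 4) #|[set v in S | S :\ v \subset [set w | e v w]]| +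
      \sum_(S : {set 'I_n} | #|S| == 4) induced_iso e (@complete_bipartite 2 2) S)%N.
    rewrite -!big_split; apply: eq_bigr => S /eqP cS /=.
    have [g [[g_sym g_irr] -> -> isoE]] := restrict_graph e_sym e_irr cS.
    by rewrite !isoE; apply: n_comp_compl4.
  by lia.
rewrite (betti_linear_strand e_sym e_irr _ F) card_strand_basis // sumE.
rewrite !sum_induced card_sum card_option !card_ord (_ : 2 + 3 = 5)%N //.
have : (\sum_(S : {set 'I_n} | #|S| == 5) (n_comp (compl_in e S) S).-1 +
    \sum_(S : {set 'I_n} | #|S| == 5) induced_iso e (@complete_graph 5) S =
  \sum_(S : {set 'I_n} | #|S| == 5) #|[set v in S | S :\ v \subset [set w | e v w]]| +
    \sum_(S : {set 'I_n} | #|S| == 5) induced_iso e (@complete_bipartite 2 3) S +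
    \sum_(S : {set 'I_n} | #|S| == 5) induced_iso e (@wheel_graph 4) S +
    \sum_(S : {set 'I_n} | #|S| == 5) induced_iso e graph_D S)%N.
  rewrite -!big_split; apply: eq_bigr => S /eqP cS /=.
  have [g [[g_sym g_irr] -> -> isoE]] := restrict_graph e_sym e_irr cS.
  by rewrite !isoE; apply: n_comp_compl5.
by lia.
Qed.
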